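(* Let $E$ be a (real) J$^*$B-triple, let $F$ be a normed Jordan triple, and let $T:E\to F$ be a continuous triple monomorphism. Then $T$ is bounded below. Equivalently, every J$^*$B-triple has minimality of triple norm topology (MOTNT).
   Context: A real (resp., complex) normed Jordan triple is a real (resp., complex) normed space $E$ (not necessarily complete) with a non-trivial (jointly) continuous triple product $E\times E\times E\to E$, $(x,y,z)\mapsto\{x,y,z\}$, which is bilinear and symmetric in the outer variables $x,z$, linear (resp., conjugate linear) in the middle variable $y$, and satisfies the Jordan identity $L(a,b)L(x,y)-L(x,y)L(a,b)=L(L(a,b)x,y)-L(x,L(b,a)y)$ for all $a,b,x,y\in E$, where $L(x,y)z:=\{x,y,z\}$. A Jordan-Banach triple is a normed Jordan triple whose norm is complete. Without further specification, these terms mean a real or complex one. For a normed Jordan triple $E$, $N(E):=\sup\{\|\{x,y,z\}\|:\|x\|,\|y\|,\|z\|\le 1\}$. A (real) J$^*$B-triple is a real Jordan-Banach triple $E$ such that $\|\{a,a,a\}\|=\|a\|^3$ for all $a\in E$; $N(E)=1$; the spectrum of $L(x,x)$ is contained in $[0,+\infty)$ for all $x\in E$; and the spectrum of $L(x,y)-L(y,x)$ is contained in $i\mathbb{R}$ for all $x,y\in E$. Here spectra are complex spectra, i.e. computed in the complexification of the real Banach algebra of bounded linear operators on $E$. A triple homomorphism is a linear map $T$ with $T(\{a,b,c\})=\{T(a),T(b),T(c)\}$ for all $a,b,c$ (real-linear if one of the two spaces is real); a triple monomorphism is an injective triple homomorphism. $T$ is bounded below if there is $c>0$ with $\|T(x)\|\ge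 c\|x\|$ for all $x$. A normed Jordan triple $(E,\|\cdot\|)$ has MOTNT if every (not necessarily complete) triple norm on $E$, i.e. norm making the triple product of $E$ continuous, which is dominated by $\|\cdot\|$ (i.e. bounded by a constant multiple of $\|\cdot\|$) defines a topology equivalent to that of $\|\cdot\|$. *)

(* Defs.v *)
From HB Require Import structures.
From mathcomp Require Import all_boot all_order all_algebra.
From mathcomp Require Import complex.
From mathcomp Require Import all_classical all_reals all_analysis.

Set Implicit Arguments.
Unset Strict Implicit.
Unset Printing Implicit Defensive.

Import Order.TTheory GRing.Theory Num.Theory.
Import numFieldNormedType.Exports.

Local Open Scope classical_set_scope.
Local Open Scope ring_scope.

(* The conjugation [cj] of the scalar field is a parameter, so that real and
   complex triples share one definition: [cj] is [id] over a [realType] [R] and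
   [conjc] over [R[i]]. *)
Record normed_jordan_triple (K : numFieldType) (cj : K -> K)
    (E : normedModType K) (tp : E -> E -> E -> E) : Prop :=
  NormedJordanTriple {
    tp_linear_outer : forall y z : E, linear (fun x => tp x y z) ;
    tp_sym_outer : forall x y z : E, tp x y z = tp z y x ;
    tp_conj_linear_middle : forall (x z : E) (a : K) (u v : E),
      tp x (a *: u + v) z = cj a *: tp x u z + tp x v z ;
    tp_continuous : continuous (fun p : E * E * E => tp p.1.1 p.1.2 p.2) ;
    tp_nontrivial : exists x y z : E, tp x y z != 0 ;
    tp_jordan : forall a b x y w : E,
      tp a b (tp x y w) - tp x y (tp a b w)
      = tp (tp a b x) y w - tp x (tp b a y) w }.

Definition tp_norm (R : realType) (E : normedModType R)
    (tp : E -> E -> E -> E) : R :=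
  sup [set r : R | exists x y z : E,
    [/\ `|x| <= 1, `|y| <= 1, `|z| <= 1 & r = `|tp x y z|]].

Section spectrum.
Variables (R : realType) (E : normedModType R).
Implicit Types (A : E -> E) (S T : (E -> E) * (E -> E)) (z : R[i]).

Definition bounded_op A : Prop := linear A /\ continuous A.

(* A pair [S] of bounded operators stands for the element [S.1 + i S.2] of the
   complexification of the algebra of bounded operators. *)
Definition cplx_mul S T : (E -> E) * (E -> E) :=
  ((fun x => S.1 (T.1 x) - S.2 (T.2 x)),
   (fun x => S.1 (T.2 x) + S.2 (T.1 x))).

Definition cplx_one : (E -> E) * (E -> E) := (id, fun=> 0).

Definition cplx_unit S : Prop :=
  exists T, [/\ bounded_op T.1, bounded_op T.2,
    cplx_mul S T = cplx_one & cplx_mul T S = cplx_one].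

(* [A - z], for [A] in the real algebra and [z] a complex scalar *)
Definition cplx_sub_scalar A z : (E -> E) * (E -> E) :=
  ((fun x => A x - complex.Re z *: x), (fun x => - (complex.Im z *: x))).

Definition op_spectrum A : set R[i] :=
  [set z | ~ cplx_unit (cplx_sub_scalar A z)].

End spectrum.

(* On [R[i]], [0 <= z] means that [z] is a nonnegative real. *)
Record JstarB_triple (R : realType) (E : completeNormedModType R)
    (tp : E -> E -> E -> E) : Prop := JstarBTriple {
  JstarB_jordan : normed_jordan_triple id tp ;
  JstarB_cube : forall a : E, `|tp a a a| = `|a| ^+ 3 ;
  JstarB_norm : tp_norm tp = 1 ;
  JstarB_spectrum_nonneg : forall x : E,
    op_spectrum (fun w => tp x x w) `<=` [set z | 0 <= z] ;
  JstarB_spectrum_imaginary : forall x y : E,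
    op_spectrum (fun w => tp x y w - tp y x w)
      `<=` [set z | complex.Re z = 0] }.

Definition triple_hom (U V : Type) (tpU : U -> U -> U -> U)
    (tpV : V -> V -> V -> V) (T : U -> V) : Prop :=
  forall a b c : U, T (tpU a b c) = tpV (T a) (T b) (T c).

Section motnt.
Variables (K : numFieldType) (E : normedModType K) (tp : E -> E -> E -> E).
Implicit Type n : E -> K.

Definition is_norm n : Prop :=
  [/\ forall x y, n (x + y) <= n x + n y,
      forall (a : K) x, n (a *: x) = `|a| * n x
    & forall x, n x = 0 -> x = 0].

Definition norm_nbhs n (x : E) : set_system E := nbhs_ball_ (ball_ n) x.

(* Joint continuity of the product for the topology defined by [n], which in
   general differs from the ambient topology of [E]. *)
Definition triple_norm n : Prop :=
  is_norm n /\
  forall x y z : E,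
    (fun p : E * E * E => tp p.1.1 p.1.2 p.2) @
      filter_prod (filter_prod (norm_nbhs n x) (norm_nbhs n y)) (norm_nbhs n z)
    `=>` norm_nbhs n (tp x y z).

Definition MOTNT : Prop :=
  forall n : E -> K, triple_norm n ->
    (exists C : K, forall x : E, n x <= C * `|x|) ->
    forall x : E, norm_nbhs n x = nbhs x.

End motnt.

(* Main.v *)
(** Let [n] be a triple norm on [E] with [n <= D |.|] and
    [n {x,y,z} <= M n(x) n(y) n(z)], and let [|a| = 1].  Put [A = L(a,a)].  Odd
    powers are associative, so that [q |-> q(A)a] turns the triple product into
    [(q1,q2,q3) |-> q1 q2 q3 X].  The spectrum of [A] lies in [[0,1]], hence
    for [b = q(A)a] the operator [(q^2 X)(A)], which acts as [L(b,b)] on the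
    powers of [b], has spectral radius at most [sup s q(s)^2], while [|b|^3 =
    |{b,b,b}|] forces the powers of [b] to grow exactly like those of [|b|].
    Thus [|q(A)a|] is at most a constant times the supremum of [|q|] on [[0,1]],
    and [f(A)a] makes sense for continuous [f].

    Suppose [rho = M n(a)^2 < c = 1/4] and take [f(s) = max(s - c, 0)].  Since
    [f = s^k (f / s^k)] with [|f / s^k| <= c^-k] and [A] shrinks [n] by the
    factor [rho], [n (f(A)a)] is at most of order [(rho/c)^k] for every [k], so
    [f(A)a = 0].  But then [1 = |Aa| = |(s - f)(A)a| <= 2c], a contradiction.
    Hence [|x|^2 <= 4 M n(x)^2] for all [x]. *)

Require Import Defs.
From HB Require Import structures.
From mathcomp Require Import all_boot all_order all_algebra.
From mathcomp Require Import complex.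
From mathcomp Require Import all_classical all_reals all_analysis.
From mathcomp Require Import zify ring lra.

Set Implicit Arguments.
Unset Strict Implicit.
Unset Printing Implicit Defensive.

Import Order.TTheory GRing.Theory Num.Theory.
Import numFieldNormedType.Exports.

Local Open Scope classical_set_scope.
Local Open Scope ring_scope.
Local Open Scope complex_scope.


(** A discrete form of connectedness: finitely many steps of length 1/(m+1) <= d lead from 0 to
    1. *)
Lemma chain_interval (R : realType) (P : R -> Prop) (d : R) :
  0 < d -> P 0 ->
  (forall t u, 0 <= t <= 1 -> 0 <= u <= 1 -> `|t - u| <= d -> P t -> P u) ->
  P 1.
Proof.
move=> d0 P0 step.
have [m hm] : exists m : nat, d^-1 <= m.+1%:R.
  exists (Num.bound d^-1); apply: ltW.
  apply: (lt_le_trans (archi_boundP _)); first by rewrite invr_ge0 ltW.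
  by rewrite ler_nat.
have m0 : (0 : R) < m.+1%:R by rewrite ltr0n.
suff H : forall i : nat, (i <= m.+1)%N -> P (i%:R / m.+1%:R).
  by have := H _ (leqnn _); rewrite divff// lt0r_neq0.
elim=> [|i IH] le; first by rewrite mul0r.
have in01 (j : nat) : (j <= m.+1)%N -> 0 <= (j%:R / m.+1%:R : R) <= 1.
  move=> jm; rewrite divr_ge0 ?ler0n//= ler_pdivrMr// mul1r.
  by rewrite ler_nat.
apply: (step (i%:R / m.+1%:R)); rewrite ?in01// 1?ltnW//; last first.
  by apply: IH; rewrite ltnW.
rewrite -mulrBl normrM -[in i.+1%:R]natr1 opprD addrA subrr add0r normrN1 mul1r.
by rewrite gtr0_norm ?invr_gt0// invf_ple ?posrE.
Qed.

(** * A spectral radius estimate *)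

Section spectral_radius.
Context (R : realType) (V : lmodType R[i]) (N : V -> R).
Hypothesis N_triangle : forall u v, N (u + v) <= N u + N v.
Hypothesis N_scale : forall (z : R[i]) v,
  N (z *: v) <= (`|complex.Re z| + `|complex.Im z|) * N v.
Hypothesis N_real : forall (k : R) v, N (k%:C *: v) = `|k| * N v.
Hypothesis N_ge0 : forall v, 0 <= N v.

Lemma N_opp v : N (- v) = N v.
Proof.
have -> : - v = (- 1)%:C *: v by rewrite rmorphN rmorph1 scaleN1r.
by rewrite N_real normrN1 mul1r.
Qed.

Lemma N_zero : N 0 = 0.
Proof. by rewrite -(scale0r 0) -(rmorph0 (real_complex R)) N_real normr0 mul0r. Qed.

Context (B : {linear V -> V}) (beta : R).
Hypothesis beta_ge0 : 0 <= beta.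
Hypothesis B_bound : forall v, N (B v) <= beta * N v.
(** Together with [B_surj]: [1 - zB] is invertible on a square containing the closed unit disc, so
    the spectrum of [B] avoids |w| >= 1. *)
Hypothesis B_lower : forall z : R[i],
  `|complex.Re z| <= 1 -> `|complex.Im z| <= 1 ->
  exists C, forall v, N v <= C * N (v - z *: B v).
Hypothesis B_surj : forall z : R[i],
  `|complex.Re z| <= 1 -> `|complex.Im z| <= 1 ->
  forall v, exists y, y - z *: B y = v.

(** A constant valid at one z serves, doubled, at all nearby z, since [zB] changes little in norm;
    compactness of the square gives a common constant. *)
Lemma B_lower_uniform : exists2 C, 0 < C & forall z : R[i],
  `|complex.Re z| <= 1 -> `|complex.Im z| <= 1 ->
  forall v, N v <= C * N (v - z *: B v).
Proof.
pose K : set (R * R) := `[-1, 1] `*` `[-1, 1].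
have cK : compact K by apply: compact_setX; exact: segment_compact.
have /compact_near_coveringP/(_ R (+oo : set_system R)
   (fun C p => forall v, N v <= C * N (v - (p.1 +i* p.2) *: B v)) _) := cK.
case.
- move=> [x y] [] /=; rewrite !in_itv/= -!ler_norml => hx hy.
  have [C0 hC0] := @B_lower (x +i* y) hx hy.
  pose C := Num.max C0 1.
  have C1 : 1 <= C by rewrite le_max lexx orbT.
  have Cpos : 0 < C by apply: lt_le_trans C1.
  have hC v : N v <= C * N (v - (x +i* y) *: B v).
    by apply: (le_trans (hC0 v)); rewrite ler_wpM2r// le_max lexx.
  (* Chosen so that 2 e (beta + 1) = 1/(2C): the perturbation costs half of [N v], which the left
     side absorbs. *)
  pose e := (4 * C * (beta + 1))^-1.
  have b1 : 0 < beta + 1 by rewrite ltr_wpDl.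
  have e0 : 0 < e by rewrite invr_gt0 !mulr_gt0.
  near=> p C'.
  move=> v.
  have C'2 : 2 * C <= C' by near: C'; apply: nbhs_pinfty_ge; exact: num_real.
  have [px py] : `|x - p.1| < e /\ `|y - p.2| < e.
    by near: p; exists (ball x e, ball y e);
      [split; exact: nbhsx_ballx|move=> q []].
  apply: (@le_trans _ _ (2 * C * N (v - (p.1 +i* p.2) *: B v))); last first.
    by rewrite ler_wpM2r.
  have e1 : v - (x +i* y) *: B v =
     v - (p.1 +i* p.2) *: B v + ((p.1 +i* p.2) - (x +i* y)) *: B v.
    by rewrite scalerBl addrA subrK.
  have := hC v; rewrite e1 => h.
  have h2 : N (((p.1 +i* p.2) - (x +i* y)) *: B v) <= (2 * C)^-1 * N v.
    apply: (le_trans (N_scale _ _)) => /=.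
    apply: (@le_trans _ _ ((e + e) * ((beta + 1) * N v))).
      apply: ler_pM => //.
        by rewrite lerD// ltW// distrC.
      apply: (le_trans (B_bound v)).
      by rewrite ler_wpM2r// lerDl.
    rewrite mulrA ler_wpM2r// /e.
    have -> : (2 * C)^-1 = ((4 * C * (beta + 1))^-1 + (4 * C * (beta + 1))^-1) * (beta + 1).
      by field; rewrite !lt0r_neq0.
    by [].
  have h3 := N_triangle (v - (p.1 +i* p.2) *: B v)
    (((p.1 +i* p.2) - (x +i* y)) *: B v).
  have h4 : N v <= C * N (v - (p.1 +i* p.2) *: B v) + 2^-1 * N v.
    apply: (le_trans h).
    apply: (@le_trans _ _ (C * (N (v - (p.1 +i* p.2) *: B v) + (2 * C)^-1 * N v))).
      by rewrite ler_pM2l// (le_trans h3)// lerD2l.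
    rewrite mulrDr lerD2l mulrA ler_wpM2r// invfM mulrCA divff ?lt0r_neq0// mulr1//.
  by move: h4; lra.
- move=> C0 [_ hC0]; exists (Num.max C0 0 + 1).
    by rewrite ltr_wpDl// le_max lexx orbT.
  move=> [zx zy]/= hx hy v.
  apply: (hC0 _ _ (zx, zy)).
    by rewrite (@le_lt_trans _ _ (Num.max C0 0)) ?ltrDl// le_max lexx.
  by rewrite /K/= !in_itv/= -!ler_norml.
Unshelve. all: by end_near.
Qed.

Let D n (z : R[i]) y := y - z *: iter n B y.

Lemma iter_lin n a u v : iter n B (a *: u + v) = a *: iter n B u + iter n B v.
Proof. by elim: n => //= n ->; rewrite linearP. Qed.

Lemma iterZ n a u : iter n B (a *: u) = a *: iter n B u.
Proof. by elim: n => //= n ->; rewrite linearZ. Qed.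

(** Difference of squares; it carries statements about [B^n] to [B^(2n)] through square roots of the
    scalar. *)
Lemma D_comp n z y : D n z (D n (- z) y) = D (n + n) (z ^+ 2) y.
Proof.
rewrite /D scaleNr opprK iterD [y + _]addrC iter_lin.
by rewrite scalerDr scalerA -expr2 opprD [_ + y]addrC addrACA subrr addr0.
Qed.

Lemma Re_Im_le1 (z : R[i]) : `|z| <= 1 ->
  `|complex.Re z| <= 1 /\ `|complex.Im z| <= 1.
Proof.
move=> z1; split; rewrite -lecR; apply: (le_trans _ z1).
  exact: normc_ge_Re.
rewrite -normrN -[X in `|X|]/(complex.Re (- complex.Im z +i* complex.Re z)).
have -> : `|z| = `|(- complex.Im z +i* complex.Re z)|.
  by rewrite !normc_def/= sqrrN addrC.
exact: normc_ge_Re.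
Qed.

(** Induction on k, factoring along [sqrtc z]. The disc replaces the square because it is stable
    under square roots. *)
Lemma D_surj k z : `|z| <= 1 -> forall v, exists y, D (2 ^ k) z y = v.
Proof.
elim: k z => [|k IH] z z1 v.
  have [a b] := Re_Im_le1 z1.
  exact: B_surj.
pose s := sqrtc z.
have s1 : `|s| <= 1.
  by rewrite -(@ler_pXn2r _ 2)// ?nnegrE// -normrX sqr_sqrtc expr1n.
have [y1 hy1] := IH s s1 v.
have [y2 hy2] := IH (- s) (eqbRL (congr1 (fun x => x <= 1) (normrN s)) s1) y1.
exists y2; rewrite expnS mul2n -addnn -[z]sqr_sqrtc -D_comp.
by rewrite hy2.
Qed.

(* The constant does not depend on [k], because for [s^2 = w] the inverse of
   [1 - w B^(2n)] is the average of the inverses of [1 - s B^n] and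
   [1 + s B^n]. *)
Lemma D_lipschitz : exists2 L, 0 < L &
  forall k (w : R[i]) t t' v y y',
  `|w| = 1 -> 0 <= t <= 1 -> 0 <= t' <= 1 ->
  D (2 ^ k) ((t ^+ (2 ^ k))%:C * w) y = v ->
  D (2 ^ k) ((t' ^+ (2 ^ k))%:C * w) y' = v ->
  N (y - y') <= L * `|t - t'| * N v.
Proof.
have [C C0 hC] := B_lower_uniform.
exists (2 * C ^+ 2 * beta + 1).
  by rewrite ltr_wpDl// !mulr_ge0// ltW.
have inball (t : R) (w : R[i]) : `|w| = 1 -> 0 <= t <= 1 -> `|t%:C * w| <= 1.
  by move=> w1 /andP[t0 t1]; rewrite normrM w1 mulr1 ger0_norm ?lecR.
elim=> [|k IH] w t t' v y y' w1 t01 t'01.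
  rewrite /D expn0 !expr1/= => hy hy'.
  have [a b] := Re_Im_le1 (inball _ _ w1 t01).
  have [a' b'] := Re_Im_le1 (inball _ _ w1 t'01).
  have h1 := hC _ a b (y - y').
  (* The resolvent identity. *)
  have e1 : y - y' - (t%:C * w) *: B (y - y') = ((t - t')%:C * w) *: B y'.
    have e0 : y - y' = (t%:C * w) *: B y - (t'%:C * w) *: B y'.
      rewrite -[y in LHS](subrK ((t%:C * w) *: B y)) hy.
      rewrite -[y' in LHS](subrK ((t'%:C * w) *: B y')) hy'.
      by rewrite opprD addrACA subrr add0r.
    by rewrite linearB scalerBr e0 opprB addrC addrA subrK -scalerBl rmorphB mulrBl.
  have h2 := hC _ a' b' y'.
  rewrite hy' in h2; rewrite e1 in h1.
  apply: (le_trans h1).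
  have [c d] := @Re_Im_le1 w (eqbRL (congr1 (fun x => x <= 1) w1) (lexx 1)).
  have h3 : N (((t - t')%:C * w) *: B y') <= `|t - t'| * (2 * N (B y')).
    rewrite -scalerA N_real ler_wpM2l//.
    apply: (le_trans (N_scale _ _)); rewrite ler_wpM2r//.
    by rewrite -[2]/(1 + 1) lerD.
  have h4 : N (B y') <= beta * (C * N v).
    by apply: (le_trans (B_bound _)); rewrite ler_wpM2l.
  have h5 : `|t - t'| * (2 * N (B y')) <= `|t - t'| * (2 * (beta * (C * N v))).
    by rewrite !ler_wpM2l.
  apply: (@le_trans _ _ (C * (`|t - t'| * (2 * (beta * (C * N v)))))).
    by rewrite ler_pM2l// (le_trans h3).
  rewrite !mulrDl mul1r -[leLHS]addr0 lerD//; last by rewrite mulr_ge0.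
  by rewrite le_eqVlt; apply/orP; left; apply/eqP; ring.
rewrite expnS mul2n -addnn => hy hy'.
pose s := sqrtc w.
have sw : w = s ^+ 2 by rewrite sqr_sqrtc.
have s1 : `|s| = 1.
  apply/eqP; rewrite -(@eqrXn2 _ 2)//; last by rewrite expr1n -normrX sqr_sqrtc w1.
have s1' : `|- s| = 1 by rewrite normrN.
have sq q : (q ^+ (2 ^ k + 2 ^ k))%:C * w = (q ^+ (2 ^ k))%:C * s * (q ^+ (2 ^ k))%:C * s.
  by rewrite exprD rmorphM sw; ring.
(* Applying one of the two factors to a solution for [w] gives a solution, at half the exponent, for
   the root s or -s. *)
have sol q (x : V) : D (2 ^ k + 2 ^ k) ((q ^+ (2 ^ k + 2 ^ k))%:C * w) x = v ->
  D (2 ^ k) ((q ^+ (2 ^ k))%:C * s) (D (2 ^ k) ((q ^+ (2 ^ k))%:C * - s) x) = v /\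
  D (2 ^ k) ((q ^+ (2 ^ k))%:C * - s) (D (2 ^ k) ((q ^+ (2 ^ k))%:C * s) x) = v.
  move=> <-; rewrite mulrN; split; last rewrite -[X in D _ X x]opprK.
    by rewrite D_comp sq; congr (D _ _ x); rewrite expr2; ring.
  by rewrite D_comp sq; congr (D _ _ x); rewrite expr2; ring.
have [p1 p2] := sol _ _ hy; have [p1' p2'] := sol _ _ hy'.
have q1 := IH _ _ _ _ _ _ s1 t01 t'01 p1 p1'.
have q2 := IH _ _ _ _ _ _ s1' t01 t'01 p2 p2'.
have avg z x : D (2 ^ k) (z * - s) x + D (2 ^ k) (z * s) x = 2%:C *: x.
  by rewrite /D mulrN scaleNr opprK addrACA subrr addr0 -mulr2n -scaler_nat rmorph_nat.
have : N (2%:C *: (y - y')) <= 2 * ((2 * C ^+ 2 * beta + 1) * `|t - t'| * N v).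
  rewrite scalerBr -(avg (t ^+ (2 ^ k))%:C y) -(avg (t' ^+ (2 ^ k))%:C y').
  rewrite opprD addrACA; apply: (le_trans (N_triangle _ _)).
  by rewrite mulr_natl mulr2n lerD.
by rewrite N_real ger0_norm// ler_pM2l.
Qed.

(* The set of [t] for which [(tB)^(2^k)] is eventually small is moved by a fixed
   step: if [t^n B^n] is small, [(1 - t^n B^n)^-1] is close to 1, and by the
   uniform Lipschitz bound so is [(1 - u^n B^n)^-1] for [u] close to [t]. *)
Lemma iter_power_small : exists k, forall v, N (iter (2 ^ k) B v) <= 12^-1 * N v.
Proof.
have [L L0 hL] := D_lipschitz.
pose P t := exists k0, forall k, (k0 <= k)%N -> forall v,
  N ((t ^+ (2 ^ k))%:C *: iter (2 ^ k) B v) <= 12^-1 * N v.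
suff [k0 hk0] : P 1.
  by exists k0 => v; have := hk0 _ (leqnn _) v; rewrite expr1n rmorph1 scale1r.
(* This step length makes the Lipschitz bound [L |t - u| N v] at most [N v / 12]. *)
apply: (@chain_interval _ P (12 * L)^-1).
- by rewrite invr_gt0 mulr_gt0.
- exists 0 => k _ v.
  by rewrite expr0n gtn_eqF ?expn_gt0// rmorph0 scale0r N_zero mulr_ge0.
move=> t u t01 u01 tu [k0 hk0].
have main k : (k0 <= k)%N -> forall y',
    N ((u ^+ (2 ^ k))%:C *: iter (2 ^ k) B y') <= 4^-1 * N y'.
  move=> hk y'.
  pose v := D (2 ^ k) ((u ^+ (2 ^ k))%:C * 1) y'.
  have w1 : `|(t ^+ (2 ^ k))%:C * 1 : R[i]| <= 1.
    move: t01 => /andP[t0 t1].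
    rewrite mulr1 ger0_norm; last by rewrite -(rmorph0 (real_complex R)) lecR exprn_ge0.
    by rewrite -(rmorph1 (real_complex R)) lecR exprn_ile1.
  (* [y] solves at t the equation that [y'] solves at u, with the same right side [v]. *)
  have [y hy] := D_surj k w1 v.
  have h1 := hL k 1 t u v y y' (normr1 _) t01 u01 hy erefl.
  have h2 := hk0 k hk y.
  have eyv : (t ^+ (2 ^ k))%:C *: iter (2 ^ k) B y = y - v.
    by rewrite -hy /D mulr1 opprB addrC subrK.
  have ev : (u ^+ (2 ^ k))%:C *: iter (2 ^ k) B y' = y' - v.
    by rewrite /v /D mulr1 opprB addrC subrK.
  clearbody v.
  rewrite ev; rewrite eyv in h2.
  have h3 : N (y - y') <= 12^-1 * N v.
    apply: (le_trans h1); rewrite ler_wpM2r//.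
    apply: (@le_trans _ _ (L * (12 * L)^-1)); first by rewrite ler_pM2l.
    by rewrite invfM mulrCA divff ?lt0r_neq0// mulr1.
  have h4 : N y <= N (y - v) + N v by rewrite -[in N y](subrK v y).
  have h5 : N (y' - v) <= N (y - y') + N (y - v).
    rewrite -[N (y - y')]N_opp opprB; apply: (le_trans _ (N_triangle _ _)).
    by rewrite addrA subrK.
  have h6 : N v <= N (y' - v) + N y'.
    rewrite -[N (y' - v)]N_opp opprB; apply: (le_trans _ (N_triangle _ _)).
    by rewrite subrK.
  (* Smallness at t gives N(y - v) <= N v / 11, hence N(y' - v) <= (1/11 + 1/12) N v; comparing N v
     with N y' leaves a factor below 1/4. *)
  by have := N_ge0 y'; lra.
(* Doubling the exponent once turns 1/4 into 1/16 < 1/12, hence the threshold k0 + 1. *)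
exists k0.+1 => -[//|k]; rewrite ltnS => hk v.
have := main k hk ((u ^+ (2 ^ k))%:C *: iter (2 ^ k) B v).
have := main k hk v.
rewrite expnS mul2n -addnn iterD exprD rmorphM -scalerA.
rewrite iterZ.
by have := N_ge0 v; lra.
Qed.

End spectral_radius.

(** * Polynomials in an operator *)

Section polynomial_calculus.
Context (K : comNzRingType) (V : lmodType K) (A : {linear V -> V}).
Implicit Types (p q : {poly K}) (u v : V).

Definition peval p v := \sum_(i < size p) p`_i *: iter i A v.

Lemma peval_wide n p v : (size p <= n)%N ->
  peval p v = \sum_(i < n) p`_i *: iter i A v.
Proof.
move=> pn; rewrite /peval (big_ord_widen n (fun i => p`_i *: iter i A v) pn).
rewrite big_mkcond; apply: eq_bigr => i _; case: ltnP => // h.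
by rewrite nth_default// scale0r.
Qed.

Lemma pevalD p q v : peval (p + q) v = peval p v + peval q v.
Proof.
pose n := maxn (size p) (size q).
rewrite (@peval_wide n p) ?leq_maxl// (@peval_wide n q) ?leq_maxr//.
rewrite (@peval_wide n) ?size_polyD// -big_split; apply: eq_bigr => i _.
by rewrite coefD scalerDl.
Qed.

Lemma pevalZ c p v : peval (c *: p) v = c *: peval p v.
Proof.
rewrite (@peval_wide (size p)) ?size_scale_leq// scaler_sumr.
by apply: eq_bigr => i _; rewrite coefZ scalerA.
Qed.

Lemma peval0 v : peval 0 v = 0.
Proof. by rewrite /peval size_poly0 big_ord0. Qed.

Lemma pevalN p v : peval (- p) v = - peval p v.
Proof. by rewrite -[- p]scaleN1r pevalZ scaleN1r. Qed.

Lemma pevalB p q v : peval (p - q) v = peval p v - peval q v.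
Proof. by rewrite pevalD pevalN. Qed.

Lemma pevalC c v : peval c%:P v = c *: v.
Proof.
by rewrite (@peval_wide 1) ?size_polyC_leq1// big_ord1 coefC.
Qed.

Lemma peval1 v : peval 1 v = v.
Proof. by rewrite -[1]/(1%:P) pevalC scale1r. Qed.

Lemma pevalMX p v : peval (p * 'X) v = peval p (A v).
Proof.
rewrite (@peval_wide (size p).+1); last first.
  by rewrite (leq_trans (size_polyMleq _ _))// size_polyX addn2.
rewrite big_ord_recl coefMX eqxx scale0r add0r; apply: eq_bigr => i _.
by rewrite coefMX/= -iterSr.
Qed.

Lemma peval_is_linear p : linear (peval p).
Proof.
move=> a u v; rewrite /peval scaler_sumr -big_split; apply: eq_bigr => i _.
have -> : iter i A (a *: u + v) = a *: iter i A u + iter i A v.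
  by elim: (i : nat) => //= n ->; rewrite linearP.
by rewrite scalerDr !scalerA mulrC.
Qed.

HB.instance Definition _ p :=
  GRing.isLinear.Build K V V *:%R (peval p) (peval_is_linear p).

Lemma peval_comm p v : peval p (A v) = A (peval p v).
Proof.
rewrite /peval linear_sum; apply: eq_bigr => i _.
by rewrite linearZ/= -iterSr.
Qed.

Lemma pevalM p q v : peval (p * q) v = peval p (peval q v).
Proof.
elim/poly_ind: p q v => [|p c IH] q v; first by rewrite mul0r !peval0.
rewrite mulrDl !pevalD pevalC mul_polyC pevalZ pevalMX -peval_comm -IH.
by rewrite mulrAC pevalMX.
Qed.

Lemma pevalX v : peval 'X v = A v.
Proof. by rewrite -['X]mul1r pevalMX peval1. Qed.

Lemma pevalXn n p v : peval (p ^+ n) v = iter n (peval p) v.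
Proof.
elim: n v => [|n IH] v; first by rewrite expr0 peval1.
by rewrite exprSr pevalM IH iterSr.
Qed.

End polynomial_calculus.

(** * The complexification of a real normed space *)

Definition cplx_space (R : realType) (E : normedModType R) : Type := (E * E)%type.

Section complexification.
Context (R : realType) (E : normedModType R).
Local Notation V := (cplx_space E).
Implicit Types (v : V) (z : R[i]).

(** Only the additive group is copied from the product; the scalars will be complex, not
    componentwise real. *)
HB.instance Definition _ := GRing.Zmodule.copy V (E * E)%type.

Definition cplx_scale z v : V :=
  (complex.Re z *: v.1 - complex.Im z *: v.2,
   complex.Re z *: v.2 + complex.Im z *: v.1).

Fact cplx_scaleA z w v : cplx_scale z (cplx_scale w v) = cplx_scale (z * w) v.
Proof.
case: z w => [a b] [c d]; rewrite /cplx_scale/=; congr pair.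
  rewrite scalerBr scalerDr !scalerA scalerBl scalerDl.
  by rewrite !opprD [- _ - (_ *: v.1)]addrC addrACA.
rewrite scalerDr scalerBr !scalerA scalerBl scalerDl.
by rewrite [_ *: v.1 - _]addrC addrACA.
Qed.

Fact cplx_scale1 : left_id 1 cplx_scale.
Proof. by case=> x y; rewrite /cplx_scale/= !scale1r !scale0r subr0 addr0. Qed.

Fact cplx_scaleDr : right_distributive cplx_scale +%R.
Proof.
move=> z [x y] [x' y']; rewrite /cplx_scale; congr pair => /=.
  by rewrite !scalerDr opprD addrACA.
by rewrite !scalerDr addrACA.
Qed.

Fact cplx_scaleDl v : {morph cplx_scale^~ v : z w / z + w}.
Proof.
move=> [a b] [c d]; rewrite /cplx_scale; congr pair => /=.
  by rewrite !scalerDl opprD addrACA.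
by rewrite !scalerDl addrACA.
Qed.

HB.instance Definition _ := GRing.Zmodule_isLmodule.Build R[i] V
  cplx_scaleA cplx_scale1 cplx_scaleDr cplx_scaleDl.

(** Homogeneous for real scalars only; a complex scalar costs the factor |Re z| + |Im z|. *)
Definition cplx_norm v : R := `|v.1| + `|v.2|.

Lemma cplx_norm_triangle u v : cplx_norm (u + v) <= cplx_norm u + cplx_norm v.
Proof. by rewrite /cplx_norm addrACA lerD// ler_normD. Qed.

Lemma cplx_norm_scale z v :
  cplx_norm (z *: v) <= (`|complex.Re z| + `|complex.Im z|) * cplx_norm v.
Proof.
have := ler_normB (complex.Re z *: v.1) (complex.Im z *: v.2).
have := ler_normD (complex.Re z *: v.2) (complex.Im z *: v.1).
by rewrite !normrZ /cplx_norm/=; lra.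
Qed.

Lemma cplx_norm_real (k : R) v : cplx_norm (k%:C *: v) = `|k| * cplx_norm v.
Proof.
by rewrite /cplx_norm/= !scale0r subr0 addr0 !normrZ mulrDr.
Qed.

Lemma cplx_norm_ge0 v : 0 <= cplx_norm v.
Proof. by rewrite addr_ge0. Qed.

Context (A : {linear E -> E}).

Definition cplx_map v : V := (A v.1, A v.2).

Fact cplx_map_linear : linear cplx_map.
Proof.
by move=> z u v; rewrite /cplx_map; congr pair;
  rewrite !linearD/= ?linearN !linearZ.
Qed.

HB.instance Definition _ :=
  GRing.isLinear.Build R[i] V V *:%R cplx_map cplx_map_linear.

(** Through this identity, estimates over [R[i]] descend to [E]. *)
Lemma peval_real (p : {poly R}) (x : E) :
  peval cplx_map (map_poly (real_complex R) p) (x, 0) = (peval A p x, 0).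
Proof.
elim/poly_ind: p x => [|p c IH] x; first by rewrite rmorph0 !peval0.
rewrite rmorphD rmorphM/= map_polyX map_polyC/= !pevalD !pevalC !pevalMX.
have e : cplx_map (x, 0) = (A x, 0) by rewrite /cplx_map/= linear0.
rewrite [X in peval _ _ X]e IH; congr pair; rewrite /= ?scale0r ?scaler0 ?subr0 ?addr0//.
Qed.

End complexification.

(** * Invertible polynomials in a contraction with nonnegative spectrum *)

Section polynomial_inverse.
Context (R : realType) (E : completeNormedModType R) (A : {linear E -> E}).
Local Notation V := (cplx_space E).
Local Notation N := (@cplx_norm R E).
Local Notation Ac := (@cplx_map R E A).
Hypothesis A_contr : forall x, `|A x| <= `|x|.
Hypothesis A_spec : op_spectrum A `<=` [set z | 0 <= z].

(** Invertibility with bounded inverse, in the form that the spectral radius estimate takes as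
    hypotheses. *)
Definition bicontinuous_surjection (T : V -> V) :=
  (exists2 C, 0 <= C & forall v, N v <= C * N (T v)) /\
  (forall v, exists y, T y = v).

Lemma bicontinuous_surjection_comp S T : bicontinuous_surjection S ->
  bicontinuous_surjection T -> bicontinuous_surjection (fun v => S (T v)).
Proof.
move=> [[C C0 hC] hS] [[D D0 hD] hT]; split.
  exists (D * C); first by rewrite mulr_ge0.
  by move=> v; apply: (le_trans (hD v)); rewrite -mulrA ler_wpM2l.
by move=> v; have [y <-] := hS v; have [x <-] := hT y; exists x.
Qed.

Lemma bounded_op_bound (T : E -> E) : bounded_op T ->
  exists2 C, 0 <= C & forall x, `|T x| <= C * `|x|.
Proof.
move=> [lT cT].
pose TL : {linear E -> E} :=
  HB.pack T (GRing.isLinear.Build R E E *:%R T lT).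
have /linear_boundedP[M [_ hM]] : bounded_near TL (nbhs 0).
  by apply: continuous_linear_bounded; exact: cT.
exists (Num.max M 0 + 1); first by rewrite addr_ge0// le_max lexx orbT.
move=> x; apply: hM.
by rewrite (@le_lt_trans _ _ (Num.max M 0)) ?ltrDl// le_max lexx.
Qed.

(** The inverse pair acts on the complexification as [T1 + i T2]; the equations between pairs, read
    on vectors, make this a two-sided inverse. *)
Lemma cplx_unit_inverse z : cplx_unit (cplx_sub_scalar A z) ->
  bicontinuous_surjection (fun v => Ac v - z *: v).
Proof.
move=> [[T1 T2] [/= b1 b2 ST TS]].
have [C1 C10 hC1] := bounded_op_bound b1.
have [C2 C20 hC2] := bounded_op_bound b2.
pose L1 : {linear E -> E} := HB.pack T1 (GRing.isLinear.Build R E E *:%R T1 b1.1).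
pose L2 : {linear E -> E} := HB.pack T2 (GRing.isLinear.Build R E E *:%R T2 b2.1).
have l1B x y : T1 (x - y) = T1 x - T1 y := linearB L1 x y.
have l1D x y : T1 (x + y) = T1 x + T1 y := linearD L1 x y.
have l2B x y : T2 (x - y) = T2 x - T2 y := linearB L2 x y.
have l2D x y : T2 (x + y) = T2 x + T2 y := linearD L2 x y.
have l1N x : T1 (- x) = - T1 x := linearN L1 x.
have l2N x : T2 (- x) = - T2 x := linearN L2 x.
have [/= ST1 ST2] : (forall x, (cplx_mul (cplx_sub_scalar A z) (T1, T2)).1 x = x) /\
  forall x, (cplx_mul (cplx_sub_scalar A z) (T1, T2)).2 x = 0 by rewrite ST.
have [/= TS1 TS2] : (forall x, (cplx_mul (T1, T2) (cplx_sub_scalar A z)).1 x = x) /\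
  forall x, (cplx_mul (T1, T2) (cplx_sub_scalar A z)).2 x = 0 by rewrite TS.
pose T (v : V) : V := (T1 v.1 - T2 v.2, T1 v.2 + T2 v.1).
pose S (v : V) : V := Ac v - z *: v.
have SE v : S v = (A v.1 - complex.Re z *: v.1 + complex.Im z *: v.2,
                   A v.2 - complex.Re z *: v.2 - complex.Im z *: v.1).
  rewrite /S; congr pair => /=; first by rewrite opprB addrA addrAC.
  by rewrite opprD addrA.
have hTS v : T (S v) = v.
  rewrite SE /T; case: v => x y /=.
  have := TS1 x; have := TS2 x; have := TS1 y; have := TS2 y.
  rewrite !l1N !l2N !opprK.
  set a := A x - _; set b := _ *: x; set c := A y - _; set d := _ *: y.
  clearbody a b c d.
  move=> /eqP; rewrite addrC subr_eq0 => /eqP e1 e2.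
  move=> /eqP; rewrite addrC subr_eq0 => /eqP e3 e4.
  rewrite l1D l1B l2B l2D e1 e3 -[in RHS]e2 -[in RHS]e4; congr pair.
    by rewrite opprB [T1 a + T1 d]addrC [LHS]addrC addrA subrK addrC.
  by rewrite addrA subrK.
have hST v : S (T v) = v.
  rewrite SE /T; case: v => x y /=.
  have := ST1 x; have := ST2 x; have := ST1 y; have := ST2 y.
  rewrite !opprK.
  move=> /eqP; rewrite subr_eq0 => /eqP e1 e2 /eqP; rewrite subr_eq0 => /eqP e3 e4.
  have bB u w : A (u - w) - complex.Re z *: (u - w) =
      A u - complex.Re z *: u - (A w - complex.Re z *: w).
    by rewrite linearB scalerBr !opprB addrACA [RHS]addrACA [- _ + _]addrC.
  have bD u w : A (u + w) - complex.Re z *: (u + w) =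
      A u - complex.Re z *: u + (A w - complex.Re z *: w).
    by rewrite linearD scalerDr opprD addrACA.
  rewrite bB bD e1 e3 scalerDr scalerBr -[in RHS]e2 -[in RHS]e4; congr pair.
    by rewrite addrA subrK.
  by rewrite opprB [A _ - _ + _]addrC [LHS]addrC addrA subrK addrC.
split; last by move=> v; exists (T v); rewrite -[RHS]hST.
exists (C1 + C2); first by rewrite addr_ge0.
move=> v; rewrite -[v in leLHS]hTS -/(S v).
move: (S v) => [x y]; rewrite /T /cplx_norm /=.
have := ler_normB (T1 x) (T2 y); have := ler_normD (T1 y) (T2 x).
by have := hC1 x; have := hC1 y; have := hC2 x; have := hC2 y; lra.
Qed.

(** The triangle inequality gives the lower bound c - 1. For surjectivity, y -> (A y - x)/c is a
    contraction of [E], and its fixed point solves A y - c y = x. *)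
Lemma sub_scalar_gt1 (c : R) : 1 < c ->
  bicontinuous_surjection (fun v => Ac v - c%:C *: v).
Proof.
move=> c1; have c0 : 0 < c by apply: lt_trans c1.
have E1 v : Ac v - c%:C *: v = (A v.1 - c *: v.1, A v.2 - c *: v.2).
  by congr pair => /=; rewrite ?scale0r ?subr0 ?addr0.
split.
  exists (c - 1)^-1; first by rewrite invr_ge0 subr_ge0 ltW.
  move=> v; rewrite E1 mulrC ler_pdivlMr ?subr_gt0// /cplx_norm/=.
  have h x : (c - 1) * `|x| <= `|A x - c *: x|.
    rewrite -normrN opprB; apply: le_trans (lerB_normD _ _).
    by rewrite normrZ gtr0_norm// mulrBl mul1r normrN lerB.
  by have := h v.1; have := h v.2; lra.
have surj x : exists y, A y - c *: y = x.
  pose f y := c^-1 *: (A y - x).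
  have fT : set_fun setT setT f by [].
  pose F : {fun [set: E] >-> [set: E]} := HB.pack f (isFun.Build _ _ _ _ f fT).
  have c10 : 0 <= c^-1 by rewrite invr_ge0 ltW.
  have ctr : is_contraction F.
    exists (NngNum c10); split; first by rewrite /= invf_lt1.
    move=> [u w] _ /=; rewrite /f -scalerBr normrZ ger0_norm//.
    by rewrite ler_wpM2l// opprB addrA subrK -linearB.
  have [|p _ hp] := banach_fixed_point ctr closedT; first by exists 0.
  exists p; have /(congr1 (fun q => c *: q)) := hp.
  rewrite /= /f scalerA divff ?lt0r_neq0// scale1r => ->.
  by rewrite opprB addrC subrK.
move=> [x y]; have [u hu] := surj x; have [w hw] := surj y.
by exists (u, w); rewrite E1 /= hu hw.
Qed.

(** Either z is not a nonnegative real and [A_spec] applies, or z is a real number above 1. *)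
Lemma sub_scalar_inverse (z : R[i]) :
  (forall s : R, 0 <= s <= 1 -> z != s%:C) ->
  bicontinuous_surjection (fun v => Ac v - z *: v).
Proof.
move=> hz; have [z0|nz0] := boolP (0 <= z); last first.
  apply: cplx_unit_inverse; apply: contrapT => nu.
  by move/negP: nz0; apply; exact: A_spec.
have ez : z = (complex.Re z)%:C by rewrite RRe_real// ger0_real.
rewrite ez; apply: sub_scalar_gt1; rewrite ltNge; apply/negP => z1.
have := hz (complex.Re z); rewrite -ez eqxx z1 andbT.
by move: z0; rewrite {1}ez lecR => -> /(_ isT).
Qed.

(** Over the algebraically closed field [R[i]], p splits into linear factors whose roots avoid
    [0,1]. *)
Lemma poly_inverse (p : {poly R[i]}) :
  (forall s : R, 0 <= s <= 1 -> ~~ root p s%:C) ->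
  bicontinuous_surjection (peval Ac p).
Proof.
move=> hp; have [r er] := closed_field_poly_normal p.
have lp0 : lead_coef p != 0.
  rewrite lead_coef_eq0; apply/eqP => p0.
  by have := hp 0; rewrite lexx ler01 p0 root0 => /(_ isT).
have hr : forall s : R, 0 <= s <= 1 -> s%:C \notin r.
  move=> s s01; have := hp s s01; apply: contra => sr.
  by rewrite er rootZ// root_prod_XsubC.
rewrite er; have -> : peval Ac (lead_coef p *: \prod_(z <- r) ('X - z%:P)) =
    fun v => peval Ac (lead_coef p)%:P (peval Ac (\prod_(z <- r) ('X - z%:P)) v).
  by apply/funext => v; rewrite -pevalM mul_polyC.
apply: (@bicontinuous_surjection_comp (peval Ac (lead_coef p)%:P)
  (peval Ac (\prod_(z <- r) ('X - z%:P)))).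
  set c := lead_coef p; have cV w : c^-1 *: (c *: w) = w :> V.
    by rewrite scalerA mulVf// scale1r.
  split.
    exists (`|complex.Re c^-1| + `|complex.Im c^-1|); first by rewrite addr_ge0.
    move=> v; rewrite pevalC -{1}[v]cV; exact: cplx_norm_scale.
  by move=> v; exists (c^-1 *: v); rewrite pevalC scalerA divff// scale1r.
elim: r hr {er} => [|z r IH] hr.
  rewrite big_nil; split.
    by exists 1 => // v; rewrite mul1r peval1.
  by move=> v; exists v; rewrite peval1.
rewrite big_cons; have -> : peval Ac (('X - z%:P) * \prod_(j <- r) ('X - j%:P)) =
    fun v => (fun u => Ac u - z *: u) (peval Ac (\prod_(j <- r) ('X - j%:P)) v).
  by apply/funext => v; rewrite pevalM pevalB pevalX pevalC.
apply: (@bicontinuous_surjection_comp (fun u => Ac u - z *: u)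
  (peval Ac (\prod_(j <- r) ('X - j%:P)))).
  apply: sub_scalar_inverse => s /hr; rewrite inE negb_or => /andP[h _].
  by rewrite eq_sym.
by apply: IH => s /hr; rewrite inE negb_or => /andP[].
Qed.

Lemma peval_bound (p : {poly R[i]}) : exists2 C, 0 <= C &
  forall v, N (peval Ac p v) <= C * N v.
Proof.
have Ac1 v : N (Ac v) <= N v by rewrite /cplx_norm lerD//=.
elim/poly_ind: p => [|p c [C C0 hC]].
  by exists 0 => // v; rewrite peval0 mul0r /cplx_norm !normr0 addr0.
exists (C + (`|complex.Re c| + `|complex.Im c|)); first by rewrite !addr_ge0.
move=> v; rewrite pevalD pevalMX pevalC (le_trans (cplx_norm_triangle _ _))//.
rewrite mulrDl lerD ?cplx_norm_scale//.
by rewrite (le_trans (hC _))// ler_wpM2l// Ac1.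
Qed.

(** For z in the square, 1 - z r has no root s in [0,1], because the real part of z r(s) is at most
    1/2. The spectral radius estimate thus applies to r(A). *)
Lemma iter_peval_small (r : {poly R}) :
  (forall s : R, 0 <= s <= 1 -> `|r.[s]| <= 2^-1) ->
  exists k, forall x, `|iter (2 ^ k) (peval A r) x| <= 12^-1 * `|x|.
Proof.
move=> hr; pose rc := map_poly (real_complex R) r.
have [beta b0 hb] := peval_bound rc.
have inv (z : R[i]) : `|complex.Re z| <= 1 -> `|complex.Im z| <= 1 ->
    bicontinuous_surjection (fun v => v - z *: peval Ac rc v).
  move=> z1 z2; have -> : (fun v => v - z *: peval Ac rc v) = peval Ac (1 - z *: rc).
    by apply/funext => v; rewrite pevalB peval1 pevalZ.
  apply: poly_inverse => s s01; rewrite /root !hornerE horner_map.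
  apply/eqP => /eqP; rewrite subr_eq0 => /eqP /(congr1 (@complex.Re R)).
  case: z z1 z2 => a b /= a1 b1 /esym/eqP; apply/negP; rewrite mulr0 subr0.
  rewrite lt_eqF//; apply: (le_lt_trans (ler_norm _)); rewrite normrM.
  apply: (@le_lt_trans _ _ (1 * 2^-1)); last by lra.
  by rewrite ler_pM// hr.
have [k hk] := @iter_power_small R V N (@cplx_norm_triangle R E)
  (@cplx_norm_scale R E) (@cplx_norm_real R E) (@cplx_norm_ge0 R E) (peval Ac rc)
  beta b0 hb (fun z a b => let: conj (ex_intro2 C _ h) _ := inv z a b in ex_intro _ C h)
  (fun z a b => (inv z a b).2).
exists k => x; have := hk (x, 0).
rewrite -!pevalXn -rmorphXn peval_real /cplx_norm/= !normr0 !addr0.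
by rewrite pevalXn.
Qed.

End polynomial_inverse.

Lemma poly_linear_ext (R : comNzRingType) (E : lmodType R) (f g : {poly R} -> E) :
  linear f -> linear g -> (forall n, f 'X^n = g 'X^n) -> f =1 g.
Proof.
move=> lf lg fg p.
pose F : {linear {poly R} -> E} := HB.pack f (GRing.isLinear.Build R _ E *:%R f lf).
pose G : {linear {poly R} -> E} := HB.pack g (GRing.isLinear.Build R _ E *:%R g lg).
rewrite -[f]/(F : _ -> _) -[g]/(G : _ -> _) -[p]coefK poly_def !linear_sum.
by apply: eq_bigr => i _; rewrite !linearZ/= fg.
Qed.

Lemma peval_poly_linear (K : comNzRingType) (V : lmodType K) (A : {linear V -> V})
  (v : V) : linear (fun p => peval A p v).
Proof. by move=> c p q; rewrite pevalD pevalZ. Qed.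

(** * Odd powers in a J*B-triple *)

Section JstarB.
Context (R : realType) (E : completeNormedModType R) (tp : E -> E -> E -> E).
Hypothesis hE : JstarB_triple tp.

Let hJ := JstarB_jordan hE.

Lemma tp_linear3 x y : linear (tp x y).
Proof. by move=> c u v; rewrite !(tp_sym_outer hJ x) (tp_linear_outer hJ). Qed.

Lemma tp_linear2 x z : linear (fun y => tp x y z).
Proof. by move=> c u v; rewrite (tp_conj_linear_middle hJ). Qed.

Lemma tp_linear1 y z : linear (fun x => tp x y z).
Proof. exact: (tp_linear_outer hJ). Qed.

Definition tp_op x y : {linear E -> E} :=
  HB.pack (tp x y) (GRing.isLinear.Build R E E *:%R (tp x y) (tp_linear3 x y)).

Lemma linear_fun_scale (f : E -> E) (lf : linear f) c x : f (c *: x) = c *: f x.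
Proof.
pose F : {linear E -> E} := HB.pack f (GRing.isLinear.Build R E E *:%R f lf).
exact: (linearZ_LR F).
Qed.

Lemma tp_le x y z : `|tp x y z| <= `|x| * `|y| * `|z|.
Proof.
have ub u v w : `|u| <= 1 -> `|v| <= 1 -> `|w| <= 1 -> `|tp u v w| <= 1.
  move=> u1 v1 w1; rewrite -(JstarB_norm hE); apply: ub_le_sup; last by exists u, v, w.
  (* An unbounded set would have the default supremum 0, not 1. *)
  apply: contrapT => nb; have := JstarB_norm hE.
  rewrite /tp_norm sup_out; first by move/eqP; rewrite eq_sym oner_eq0.
  by case.
have nz (u : E) : u != 0 -> `| `|u|^-1 *: u| <= 1.
  by move=> u0; rewrite normrZ normfV normr_id mulVf ?normr_eq0.
have tp0 : [/\ forall u v, tp 0 u v = 0, forall u v, tp u 0 v = 0 & forall u v, tp u v 0 = 0].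
  split=> u v; first by have := linear_fun_scale (tp_linear1 u v) 0 0; rewrite !scale0r.
    by have := linear_fun_scale (tp_linear2 u v) 0 0; rewrite !scale0r.
  by have := linear_fun_scale (tp_linear3 u v) 0 0; rewrite !scale0r.
case: tp0 => t1 t2 t3.
have [->|x0] := eqVneq x 0; first by rewrite t1 normr0 !mul0r.
have [->|y0] := eqVneq y 0; first by rewrite t2 normr0 mulr0 mul0r.
have [->|z0] := eqVneq z 0; first by rewrite t3 normr0 mulr0.
have := ub _ _ _ (nz x x0) (nz y y0) (nz z z0).
rewrite (linear_fun_scale (tp_linear1 _ _)) (linear_fun_scale (tp_linear2 _ _)) (linear_fun_scale (tp_linear3 _ _)).
rewrite !normrZ !normfV !normr_id.
rewrite ler_pdivrMl ?normr_gt0// ler_pdivrMl ?normr_gt0// ler_pdivrMl ?normr_gt0//.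
by rewrite mulr1 mulrA mulrC [`|z| * _]mulrC mulrA.
Qed.

Section powers.
Context (a : E).
Let A := tp_op a a.
(** The odd power of [a] with exponent 2i + 1. *)
Let p i := iter i A a.

(* With [c] the commutator of [L(a,a)] and [L(a^(n),a)], the Jordan identity
   makes [L(p k, p (n+1-k))] an arithmetic progression in [k] of difference [c],
   and its instance with the two operators exchanged gives [(n + 2) c = 0]. *)
Lemma tp_powers_sum n : forall i j, (i + j)%N = n -> forall w,
  tp (p i) (p j) w = tp (p n) a w.
Proof.
elim: n => [|n IH] i j.
  by move=> /eqP; rewrite addn_eq0 => /andP[/eqP -> /eqP ->].
move=> ij w.
pose c := A (tp (p n) a w) - tp (p n) a (A w).
have step k l : (k + l)%N = n ->
    tp (p k.+1) (p l) w = tp (p k) (p l.+1) w + c.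
  move=> kl; have := tp_jordan hJ a a (p k) (p l) w.
  by rewrite !(IH k l kl) -/c => ->; rewrite addrC subrK.
have arith k : (k <= n.+1)%N ->
    tp (p k) (p (n.+1 - k)) w = tp a (p n.+1) w + c *+ k.
  elim: k => [|k IHk] kn; first by rewrite subn0 mulr0n addr0.
  rewrite subSS step ?subnKC// -subSn// IHk; last exact: ltnW.
  by rewrite -addrA -mulrSr.
have top : tp (p n.+1) a w = tp a (p n.+1) w + c *+ n.+1.
  by rewrite -arith// subnn.
have := tp_jordan hJ (p n) a a a w.
have -> : tp (p n) a a = p n.+1 by rewrite (tp_sym_outer hJ).
have -> : tp a (p n) a = p n.+1.
  by rewrite -[X in tp X _ _]/(p 0) (IH 0 n)// (tp_sym_outer hJ).
rewrite top [RHS]addrC addrA addNr add0r => ec.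
have c0 : c *+ n.+2 = 0.
  by rewrite mulrSr -ec /c -opprB addNr.
have {}c0 : c = 0.
  by move/eqP: c0; rewrite -scaler_nat scaler_eq0 pnatr_eq0 => /= /eqP.
have := arith i; rewrite -ij leq_addr => /(_ isT); rewrite addKn => ->.
by rewrite ij c0 !mul0rn.
Qed.

(** The right side of the Jordan identity vanishes, as L(p (n+1), a) = L(p n, p 1). *)
Lemma tp_powers_comm n w : A (tp (p n) a w) = tp (p n) a (A w).
Proof.
have := tp_jordan hJ a a (p n) a w.
rewrite -[tp a a (p n)]/(p n.+1) -[tp a a a]/(p 1).
rewrite (@tp_powers_sum n.+1 n 1) ?addn1// subrr => /eqP.
by rewrite subr_eq0 => /eqP.
Qed.

(** Power associativity: exponents 2i+1, 2j+1, 2k+1 add up to 2(i+j+k+1) + 1, whence the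
    successor. *)
Lemma tp_powers i j k : tp (p i) (p j) (p k) = p (i + j + k).+1.
Proof.
rewrite (tp_powers_sum (erefl (i + j)%N)); elim: k => [|k IHk].
  by rewrite addn0 -[p 0]/a (tp_sym_outer hJ).
by rewrite -[p k.+1]/(A (p k)) -tp_powers_comm IHk addnS.
Qed.

Lemma peval_Xn_iter n : peval A 'X^n a = p n.
Proof.
by rewrite -['X]/('X) pevalXn; elim: n => //= n ->; rewrite pevalX.
Qed.

(** Trilinear extension of [tp_powers] from monomials; the factor 'X is the successor in the
    index. *)
Lemma tp_peval q1 q2 q3 :
  tp (peval A q1 a) (peval A q2 a) (peval A q3 a) = peval A (q1 * q2 * q3 * 'X) a.
Proof.
have lin (f : E -> E) (g : {poly R} -> E) : linear f -> linear g -> linear (f \o g).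
  by move=> lf lg c u v /=; rewrite lg lf.
have pl := @peval_poly_linear R E A a.
move: q3; apply: (@poly_linear_ext _ _ (fun q3 => _) (fun q3 => _)).
- exact: (lin _ _ (tp_linear3 _ _) pl).
- by move=> c u v; rewrite mulrDr mulrDl -!scalerAr -!scalerAl pl.
move=> k; move: q2; apply: (@poly_linear_ext _ _ (fun q2 => _) (fun q2 => _)).
- exact: (lin _ _ (tp_linear2 _ _) pl).
- by move=> c u v; rewrite mulrDr !mulrDl -!scalerAr -!scalerAl pl.
move=> j; move: q1; apply: (@poly_linear_ext _ _ (fun q1 => _) (fun q1 => _)).
- exact: (lin _ _ (tp_linear1 _ _) pl).
- by move=> c u v; rewrite !mulrDl -!scalerAl pl.
by move=> i; rewrite -!exprD -exprSr !peval_Xn_iter tp_powers.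
Qed.

(* Equality holds for the indices [0, 1, 4, 13, ...], as [p (3i+1)] is the cube
   of [p i]; the others lie below one of these. *)
Lemma norm_power_ge j : `|a| ^+ (2 * j).+1 <= `|p j|.
Proof.
have up i k : `|p (i + k)| <= `|a| ^+ (2 * k) * `|p i|.
  elim: k => [|k IHk]; first by rewrite addn0 muln0 expr0 mul1r.
  rewrite addnS mulnS exprD -mulrA.
  apply: (le_trans (tp_le _ _ _)); rewrite -expr2 ler_wpM2l//.
have [i ij hi] : exists2 i, (j <= i)%N & `|p i| = `|a| ^+ (2 * i).+1.
  elim: j => [|j [i ij hi]]; first by exists 0%N; rewrite // muln0 expr1.
  exists (i + i + i).+1; first by rewrite ltnS (leq_trans ij)// -addnA leq_addr.
  by rewrite -tp_powers (JstarB_cube hE) hi -exprM; congr (_ ^+ _); lia.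
have [->|a0] := eqVneq a 0; first by rewrite normr0 expr0n.
(* Passing from j up to the exact index i gains at most a factor |a|^2 per step. *)
have := up j (i - j)%N; rewrite subnKC// hi.
have -> : (2 * i).+1 = (2 * (i - j) + (2 * j).+1)%N by lia.
by rewrite exprD ler_pM2l// exprn_gt0// normr_gt0.
Qed.

End powers.

(** If |b| >= 1 for b = q(A)a, the powers of b would be at least |b|, whereas some power of (q^2
    X)(A) shrinks b by 12. *)
Lemma peval_lt1 (a : E) (q : {poly R}) : `|a| <= 1 ->
  (forall s : R, 0 <= s <= 1 -> `|q.[s] ^+ 2 * s| <= 2^-1) ->
  `|peval (tp_op a a) q a| < 1.
Proof.
move=> a1 hq; rewrite ltNge; apply/negP => b1.
set A := tp_op a a; set b := peval A q a in b1.
have A1 x : `|A x| <= `|x|.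
  apply: (le_trans (tp_le _ _ _)); rewrite -[leRHS]mul1r ler_wpM2r//.
  by rewrite mulr_ile1.
have [k hk] : exists k, forall x, `|iter (2 ^ k) (peval A (q ^+ 2 * 'X)) x| <= 12^-1 * `|x|.
  apply: iter_peval_small => //.
    have := @JstarB_spectrum_nonneg _ _ _ hE a.
    by rewrite [X in op_spectrum X](_ : _ = A :> (E -> E)).
  by move=> s s01; rewrite !hornerE; exact: hq.
(* Every power of b is some q'(A)a, and on such vectors L(b,b) acts as (q^2 X)(A). *)
have ib j : iter j (tp_op b b) b = iter j (peval A (q ^+ 2 * 'X)) b.
  suff [q' [-> ->]] : exists q', iter j (tp_op b b) b = peval A q' a /\
      iter j (peval A (q ^+ 2 * 'X)) b = peval A q' a by [].
  elim: j => [|j [q' [h1 h2]]]; first by exists q.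
  exists (q ^+ 2 * 'X * q'); rewrite /= h1 h2 -pevalM; split=> //.
  by rewrite /b /= tp_peval; congr peval; ring.
have := norm_power_ge b (2 ^ k); rewrite ib => h.
have := le_trans h (hk b); apply/negP; rewrite -ltNge.
apply: (@lt_le_trans _ _ `|b|).
  have : 0 < `|b| by apply: lt_le_trans b1.
  by lra.
by rewrite -[leLHS]expr1 ler_weXn2l.
Qed.

(** [peval_lt1] for q/(2d), which is at most 1/2 on [0,1]. *)
Lemma peval_le (a : E) (q : {poly R}) (d : R) : `|a| <= 1 -> 0 < d ->
  (forall s : R, 0 <= s <= 1 -> `|q.[s]| <= d) ->
  `|peval (tp_op a a) q a| <= 2 * d.
Proof.
move=> a1 d0 hq.
have := @peval_lt1 a ((2 * d)^-1 *: q) a1.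
rewrite pevalZ normrZ gtr0_norm ?invr_gt0 ?mulr_gt0//.
rewrite ltr_pdivrMl ?mulr_gt0// mulr1 => h; apply/ltW/h.
move=> s /andP[s0 s1]; rewrite hornerZ normrM (ger0_norm s0) normrX normrM.
rewrite gtr0_norm ?invr_gt0 ?mulr_gt0//.
have hs : `|q.[s]| <= d by apply: hq; rewrite s0.
have e : (2 * d)^-1 * `|q.[s]| <= 2^-1.
  by rewrite ler_pdivrMl ?mulr_gt0// mulrAC divff// mul1r.
have e0 : 0 <= (2 * d)^-1 * `|q.[s]| by rewrite mulr_ge0// invr_ge0 mulr_ge0// ltW.
move: (_ * _) e e0 => y y2 y0; rewrite expr2.
apply: (@le_trans _ _ (2^-1 * 1 * 1)); last by lra.
by rewrite !ler_pM ?mulr_ge0//; lra.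
Qed.

End JstarB.

(** * Limits with rates *)

Lemma le_of_vanishing (R : realType) (e : nat -> R) (x y K : R) :
  e @ \oo --> 0 -> (forall m, x <= K * e m + y) -> x <= y.
Proof.
move=> e0 h; have : (fun m => K * e m + y) @ \oo --> K * 0 + y.
  by apply: cvgD; [exact: cvgMr|exact: cvg_cst].
by rewrite mulr0 add0r => /cvgr_to_ge; apply; exact: nearW.
Qed.

(** Completeness gives the limit, and l tending to infinity keeps the rate. In this way f(A)a arises
    from polynomials. *)
Lemma cvg_harmonic_bound (R : realType) (E : completeNormedModType R)
  (u : nat -> E) (K : R) :
  (forall m l, (m <= l)%N -> `|u m - u l| <= K * harmonic m) ->
  exists U, forall m, `|U - u m| <= K * harmonic m.
Proof.
move=> h; have cu : cvg (u @ \oo).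
  apply/cauchy_cvgP; apply: cauchy_exP => e e0.
  have : (fun m => K * harmonic m) @ \oo --> K * (0 : R) by apply: cvgMr; exact: cvg_harmonic.
  rewrite mulr0 => /cvgr_lt /(_ _ e0) [m _ hm].
  exists (u m); exists m => // l /= ml.
  by rewrite -ball_normE /ball_/=; apply: (le_lt_trans (h _ _ ml)); exact: hm (leqnn _).
exists (lim (u @ \oo)) => m.
have : (fun l => `|u l - u m|) @ \oo --> `|lim (u @ \oo) - u m|.
  by apply: cvg_norm; apply: cvgB => //; exact: cvg_cst.
move=> /cvgr_to_le; apply; exists m => // l /= ml.
by rewrite distrC h.
Qed.

(** * Polynomial approximation of the positive part of s - c *)

Section positive_part.
Context (R : realType) (c : R).
Hypothesis c01 : 0 <= c <= 1.

(* Newton-like iteration for the square root [|s - c|] of [(s - c)^2]. *)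
Fixpoint abs_poly m : {poly R} :=
  if m is m'.+1
  then abs_poly m' + 2^-1 *: (('X - c%:P) ^+ 2 - abs_poly m' ^+ 2) else 0.

(** With t = |s - c| and w the current value, one step multiplies the error t - w by 1 - (t + w)/2
    <= 1 - t/2, and (1 - t/2)(1 + (m+1)t/2) <= 1 + mt/2. For t > 0 the error is thus at most 2/m,
    uniformly in s. *)
Lemma abs_poly_bound m (s : R) : 0 <= s <= 1 ->
  0 <= (abs_poly m).[s] <= `|s - c| /\
  (`|s - c| - (abs_poly m).[s]) * (1 + m%:R * `|s - c| / 2) <= `|s - c|.
Proof.
move=> s01.
have t1 : `|s - c| <= 1 by move: c01 s01; rewrite ler_norml; lra.
have t0 := normr_ge0 (s - c).
have sq : (s - c) ^+ 2 = `|s - c| ^+ 2 by rewrite real_normK// num_real.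
elim: m => [|m [/andP[w0 wt] IH]].
  by rewrite /= horner0 lexx t0 mul0r mul0r addr0 mulr1 subr0.
rewrite /= !hornerE sq -[in m.+1%:R]natr1; move: (abs_poly m).[s] w0 wt IH => w w0 wt IH.
move: `|s - c| t0 t1 wt IH {sq} => t t0 t1 wt IH.
have m0 : (0 : R) <= m%:R := ler0n _ _.
have e1 : t - (w + 2^-1 * (t ^+ 2 - w ^+ 2)) = (t - w) * (1 - (t + w) / 2) by field.
split.
  apply/andP; split.
    rewrite addr_ge0// mulr_ge0// subr_ge0 ler_pXn2r// nnegrE//.
  rewrite -subr_ge0 e1 mulr_ge0//; lra.
rewrite e1; apply: le_trans IH; rewrite -mulrA ler_wpM2l ?subr_ge0//.
apply: (@le_trans _ _ ((1 - t / 2) * (1 + (m%:R + 1) * t / 2))).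
  rewrite ler_wpM2r//; last by lra.
  by rewrite addr_ge0// !mulr_ge0// addr_ge0.
have : 0 <= (m%:R + 1) * (t * t) by rewrite !mulr_ge0// addr_ge0.
by lra.
Qed.

Definition pos_part (s : R) := Num.max (s - c) 0.

(** The positive part is half of s - c + |s - c|; the index m + 1 makes the error at most
    1/(m+1). *)
Definition pos_part_poly m : {poly R} :=
  2^-1 *: ('X - c%:P + abs_poly m.+1).

Lemma pos_part_polyP m (s : R) : 0 <= s <= 1 ->
  `|(pos_part_poly m).[s] - pos_part s| <= harmonic m.
Proof.
move=> s01; have [/andP[w0 wt] h] := abs_poly_bound m.+1 s01.
have ef : pos_part s = 2^-1 * (s - c + `|s - c|).
  rewrite /pos_part; case: (ltrP (s - c) 0) => sc.
    by rewrite ltr0_norm// addrN mulr0.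
  by rewrite ger0_norm//; field.
rewrite ef /pos_part_poly hornerZ hornerD hornerXsubC -mulrBr opprD addrACA subrr add0r.
rewrite normrM gtr0_norm ?invr_gt0// distrC ger0_norm ?subr_ge0// /=.
move: (abs_poly m.+1).[s] w0 wt h => w w0 wt h.
(* The general bound is divided by |s - c|. *)
have [t0|t0] := eqVneq `|s - c| 0.
  move: wt; rewrite t0 => wt; have -> : w = 0 by lra.
  by rewrite subr0 mulr0 invr_ge0 ler0n.
have tp : 0 < `|s - c| by rewrite lt0r t0/=.
rewrite -[leRHS]mul1r ler_pdivlMr ?ltr0n// -(ler_pM2r tp) mul1r.
by move: h wt; lra.
Qed.

Lemma pos_part_ge0 s : 0 <= pos_part s.
Proof. by rewrite /pos_part le_max lexx orbT. Qed.

Lemma pos_part_le1 s : 0 <= s <= 1 -> pos_part s <= 1.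
Proof. by move: c01 => c01' s01; rewrite /pos_part ge_max; apply/andP; lra. Qed.

(** The difference is min(s, c). *)
Lemma sub_pos_part_le s : 0 <= s <= 1 -> `|s - pos_part s| <= c.
Proof.
move: c01 => c01' s01; rewrite /pos_part; case: (ltrP (s - c) 0) => h.
  by rewrite subr0 ger0_norm; lra.
by rewrite opprB addrC subrK ger0_norm; lra.
Qed.

End positive_part.

(** * Polynomial substitutes for 1/s *)

Section inverse_poly.
Context (R : realType).

(** The truncated geometric series of 1/s in powers of 1 - s. *)
Definition inv_poly l : {poly R} := \sum_(i < l) (1 - 'X) ^+ i.

Lemma inv_polyE l : 'X * inv_poly l = 1 - (1 - 'X) ^+ l.
Proof.
rewrite /inv_poly; elim: l => [|l IH]; first by rewrite big_ord0 mulr0 expr0 subrr.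
by rewrite big_ord_recr/= mulrDr IH exprS; ring.
Qed.

Lemma inv_poly_bounds l (s : R) : 0 <= s <= 1 ->
  [/\ 0 <= (inv_poly l).[s], (inv_poly l).[s] <= l%:R & s * (inv_poly l).[s] <= 1].
Proof.
move=> /andP[s0 s1].
have q i : 0 <= (1 - s) ^+ i by rewrite exprn_ge0// subr_ge0.
split.
- by rewrite /inv_poly horner_sum sumr_ge0// => i _; rewrite !hornerE.
- rewrite /inv_poly horner_sum -[l in leRHS]card_ord -sumr_const ler_sum// => i _.
  by rewrite !hornerE exprn_ile1 ?subr_ge0// lerBlDr lerDl.
- have := congr1 (horner^~ s) (inv_polyE l); rewrite !hornerE => ->.
  by rewrite lerBlDr lerDl.
Qed.

End inverse_poly.

(** Bernoulli's inequality. *)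
Lemma one_sub_expr_le (R : realType) (y : R) k : 0 <= y <= 1 -> 1 - (1 - y) ^+ k <= k%:R * y.
Proof.
move=> /andP[y0 y1]; elim: k => [|k IH]; first by rewrite expr0 subrr mul0r.
rewrite exprS -[in leRHS]natr1.
have : (1 - y) ^+ k <= 1 by rewrite exprn_ile1 ?subr_ge0// lerBlDr lerDl.
by nra.
Qed.

(** * Minimality of the norm *)

Section minimality.
Context (R : realType) (E : completeNormedModType R) (tp : E -> E -> E -> E).
Hypothesis hE : JstarB_triple tp.
Context (n : E -> R) (D M : R).
Hypothesis n_triangle : forall x y, n (x + y) <= n x + n y.
Hypothesis n_scale : forall (k : R) x, n (k *: x) = `|k| * n x.
Hypothesis n_sep : forall x, n x = 0 -> x = 0.
Hypothesis n_dom : forall x, n x <= D * `|x|.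
Hypothesis n_tp : forall x y z, n (tp x y z) <= M * n x * n y * n z.
Hypothesis D_ge0 : 0 <= D.
Hypothesis M_ge0 : 0 <= M.

Lemma n_ge0 x : 0 <= n x.
Proof.
have n0 : n 0 = 0 by rewrite -(scale0r 0) n_scale normr0 mul0r.
have := n_triangle x (- x); rewrite subrr n0 -scaleN1r n_scale normrN1 mul1r.
by lra.
Qed.

Section peak.
Context (a : E).
Hypothesis a1 : `|a| = 1.
Hypothesis na : M * n a ^+ 2 < 4^-1.

Let A : {linear E -> E} := tp_op hE a a.
Let rho := M * n a ^+ 2.
(** Small enough that 2c < 1, the final contradiction; [na] then says rho < c. *)
Let c : R := 4^-1.
Let f := pos_part_poly c.

Let c01 : 0 <= c <= 1. Proof. by rewrite /c; lra. Qed.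

Let c_gt0 : 0 < c. Proof. by rewrite /c; lra. Qed.

Let cV_ge0 : 0 <= c^-1. Proof. by rewrite /c; lra. Qed.

Let peval_sup (q : {poly R}) (d : R) : 0 < d ->
  (forall s : R, 0 <= s <= 1 -> `|q.[s]| <= d) -> `|peval A q a| <= 2 * d.
Proof. by apply: peval_le; rewrite a1. Qed.

Let harmonic_gt0 m : 0 < (harmonic m : R).
Proof. by rewrite /= invr_gt0 ltr0n. Qed.

(** Both polynomials are within [harmonic m] of the positive part; the other factor 2 is that of
    [peval_le]. *)
Let f_cauchy m l : (m <= l)%N ->
  `|peval A (f m) a - peval A (f l) a| <= 4 * harmonic m.
Proof.
move=> ml; rewrite -pevalB.
have -> : 4 * harmonic m = 2 * (2 * harmonic m) :> R by ring.
apply: peval_sup; first by rewrite mulr_gt0.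
move=> s s01; rewrite hornerD hornerN.
have h1 := pos_part_polyP c01 m s01; have h2 := pos_part_polyP c01 l s01.
have h3 : harmonic l <= harmonic m :> R.
  by rewrite /= lef_pV2 ?posrE ?ltr0n// ler_nat.
have := ler_normB ((f m).[s] - pos_part c s) ((f l).[s] - pos_part c s).
rewrite opprB addrA subrK => h; apply: (le_trans h).
by rewrite mulr2n mulrDl mul1r lerD// (le_trans h2).
Qed.

Let n_iter k x : n (iter k A x) <= rho ^+ k * n x.
Proof.
elim: k => [|k IH]; first by rewrite expr0 mul1r.
have r0 : 0 <= rho by rewrite mulr_ge0// exprn_ge0// n_ge0.
rewrite iterS exprS -mulrA; apply: (le_trans (n_tp _ _ _)).
by rewrite /rho expr2 -!mulrA !ler_wpM2l ?n_ge0//; rewrite !mulrA in IH *.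
Qed.

Let n_sub x y : n x <= D * `|x - y| + n y.
Proof.
by rewrite -{1}[x](subrK y); apply: (le_trans (n_triangle _ _)); rewrite lerD2r.
Qed.

Let iterA j x : iter j A x = peval A 'X^j x.
Proof. by rewrite pevalXn; elim: j => //= j ->; rewrite pevalX. Qed.

(** The first two terms bound the distance from f_m(A)a to A^k Q(A)a, the last two bound n(A^k
    Q(A)a) by rho^k n(Q(A)a). Within each pair, one term comes from s <= c and the other from s >
    c. *)
Let n_approx k l m : n (peval A (f m) a) <=
  2 * D * harmonic m + 4 * D * k%:R * (1 - c) ^+ l
  + 2 * D * (rho ^+ k * (l%:R ^+ k * harmonic m)) + 4 * D * (rho / c) ^+ k.
Proof.
(* [Q] is a polynomial substitute for [f / s^k]. *)
pose Q := f m * inv_poly R l ^+ k.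
(* Up to c the positive part is 0, so [f m] is pure approximation error. *)
have fc (s : R) : 0 <= s <= 1 -> s <= c -> `|(f m).[s]| <= harmonic m.
  move=> s01 sc; have := pos_part_polyP c01 m s01.
  by rewrite /pos_part (_ : Num.max _ _ = 0) ?subr0//; apply/max_idPr; rewrite subr_le0.
have f2 (s : R) : 0 <= s <= 1 -> `|(f m).[s]| <= 2.
  move=> s01; have h := pos_part_polyP c01 m s01.
  have h1 := pos_part_le1 c01 s01; have h0 := pos_part_ge0 c s.
  have hm : harmonic m <= 1 :> R by rewrite /= invf_le1 ?ltr0n// ler1n.
  by move: h; rewrite !ler_norml; move: hm h1 h0; rewrite /f; lra.
have h1 : `|peval A (f m) a - iter k A (peval A Q a)| <=
    2 * (harmonic m + 2 * (k%:R * (1 - c) ^+ l)).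
  have -> : iter k A (peval A Q a) = peval A ('X ^+ k * Q) a.
    by rewrite iterA -pevalM; reflexivity.
  rewrite -pevalB; apply: peval_sup.
    rewrite ltr_wpDr// !mulr_ge0// exprn_ge0//; rewrite /c; lra.
  move=> s s01; have /andP[s0 s1] := s01.
  have e : ('X ^+ k * Q).[s] = (f m).[s] * (1 - (1 - s) ^+ l) ^+ k.
    rewrite /Q mulrCA -exprMn inv_polyE hornerM; congr (_ * _).
    by rewrite !hornerE.
  rewrite hornerD hornerN e -[X in X - _]mulr1 -mulrBr normrM.
  have y01 : 0 <= (1 - s) ^+ l <= 1.
    by rewrite exprn_ge0 ?subr_ge0//= exprn_ile1 ?subr_ge0// lerBlDr lerDl.
  have g0 : 0 <= 1 - (1 - (1 - s) ^+ l) ^+ k.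
    by move: y01 => /andP[y0 y1]; rewrite subr_ge0 exprn_ile1 ?subr_ge0// lerBlDr lerDl.
  have g1 : 1 - (1 - (1 - s) ^+ l) ^+ k <= 1.
    by move: y01 => /andP[y0 y1]; rewrite lerBlDr lerDl exprn_ge0// subr_ge0.
  rewrite (ger0_norm g0).
  have [sc|cs] := lerP s c.
    apply: (@le_trans _ _ (harmonic m * 1)).
      by rewrite ler_pM ?fc.
    rewrite mulr1 lerDl !mulr_ge0// exprn_ge0//; rewrite /c; lra.
  apply: (@le_trans _ _ (2 * (k%:R * (1 - c) ^+ l))); last by rewrite lerDr ltW.
  apply: ler_pM => //; first exact: f2.
  apply: (le_trans (one_sub_expr_le k y01)); rewrite ler_wpM2l//.
  by apply: lerXn2r; rewrite ?nnegrE; move: cs; rewrite /c; lra.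
have h2 : `|peval A Q a| <= 2 * (l%:R ^+ k * harmonic m + 2 * (c^-1) ^+ k).
  apply: peval_sup.
    apply: ltr_wpDl.
      by apply: mulr_ge0; [rewrite exprn_ge0|rewrite ltW].
    by rewrite mulr_gt0// exprn_gt0// invr_gt0 /c invr_gt0.
  move=> s s01; have /andP[s0 s1] := s01.
  have [g0 gl sg] := inv_poly_bounds l s01.
  rewrite /Q hornerM horner_exp normrM (ger0_norm (exprn_ge0 _ g0)).
  have [sc|cs] := lerP s c.
    apply: (@le_trans _ _ (l%:R ^+ k * harmonic m)).
      by rewrite mulrC ler_pM ?exprn_ge0 ?lerXn2r ?nnegrE ?ler0n ?fc.
    by rewrite lerDl mulr_ge0 ?exprn_ge0.
  apply: (@le_trans _ _ (2 * c^-1 ^+ k)); last first.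
    by rewrite lerDr mulr_ge0 ?exprn_ge0//; exact: ltW.
  apply: ler_pM; rewrite ?exprn_ge0// ?f2//.
  apply: lerXn2r; rewrite ?nnegrE ?invr_ge0//.
  rewrite -[leRHS]mul1r ler_pdivlMr ?c_gt0// mulrC; apply: le_trans sg.
  by rewrite ler_wpM2r// ltW.
apply: (le_trans (n_sub _ (iter k A (peval A Q a)))).
have h3 := n_iter k (peval A Q a).
have r0 : 0 <= rho ^+ k by rewrite exprn_ge0// mulr_ge0// exprn_ge0// n_ge0.
have h4 : rho ^+ k * n (peval A Q a) <=
    rho ^+ k * (D * (2 * (l%:R ^+ k * harmonic m + 2 * (c^-1) ^+ k))).
  by rewrite ler_wpM2l// (le_trans (n_dom _))// ler_wpM2l.
have h5 := ler_wpM2l D_ge0 h1.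
rewrite [(rho / c) ^+ k]exprMn; move: h3 h4 h5.
move: (rho ^+ k) (c^-1 ^+ k) (l%:R ^+ k) (harmonic m) ((1 - c) ^+ l) => r cv lk h y.
by lra.
Qed.

Lemma no_small_unit_vector : False.
Proof.
have [u hu] := cvg_harmonic_bound f_cauchy.
have r0 : 0 <= rho by rewrite mulr_ge0// exprn_ge0// n_ge0.
(* The order of limits matters: m first, since [l^k] multiplies [harmonic m], then l, since k
   multiplies (1 - c)^l, and k last. *)
have bound k l : n u <= 4 * D * k%:R * (1 - c) ^+ l + 4 * D * (rho / c) ^+ k.
  apply: (@le_of_vanishing _ harmonic _ _
    (4 * D + 2 * D + 2 * D * (rho ^+ k * l%:R ^+ k)) (@cvg_harmonic R)) => m.
  have h1 := n_sub u (peval A (f m) a).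
  have h2 := ler_wpM2l D_ge0 (hu m).
  have h3 := n_approx k l m.
  by lra.
have bound2 k : n u <= 4 * D * (rho / c) ^+ k.
  apply: (@le_of_vanishing _ (fun l => (1 - c) ^+ l) _ _ (4 * D * k%:R)) => //.
  by apply: cvg_expr; rewrite ger0_norm /c; lra.
have nu : n u <= 0.
  apply: (@le_of_vanishing _ (fun k => (rho / c) ^+ k) _ _ (4 * D)).
    apply: cvg_expr; rewrite ger0_norm; last by rewrite mulr_ge0.
    by rewrite ltr_pdivrMr ?c_gt0// mul1r.
  by move=> k; rewrite addr0.
have u0 : u = 0.
  by apply: n_sep; apply/eqP; rewrite eq_le nu n_ge0.
have Aa : `|A a| = 1 by rewrite (JstarB_cube hE) a1 expr1n.
suff : (1 : R) <= 2 * c by rewrite /c; lra.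
(* 6 = 4 + 2: the rate in [hu], where u = 0, and twice the error of [f m]. *)
apply: (@le_of_vanishing _ harmonic _ _ 6 (@cvg_harmonic R)) => m.
have h1 := hu m; rewrite u0 sub0r normrN in h1.
have h2 : `|A a - peval A (f m) a| <= 2 * (c + harmonic m).
  rewrite -pevalX -pevalB; apply: peval_sup.
    by apply: addr_gt0; [exact: c_gt0|exact: harmonic_gt0].
  move=> s s01; rewrite hornerD hornerN hornerX.
  have h3 := sub_pos_part_le c01 s01; have h4 := pos_part_polyP c01 m s01.
  have := ler_normB (s - pos_part c s) ((f m).[s] - pos_part c s).
  by rewrite opprB addrA subrK => h; apply: (le_trans h); rewrite lerD.
have h3 : `|A a| <= `|A a - peval A (f m) a| + `|peval A (f m) a|.
  by rewrite -{1}[A a](subrK (peval A (f m) a)) ler_normD.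
rewrite Aa in h3; move: h1 h2 h3; move: (harmonic m) => h; lra.
Qed.

End peak.

(** A violation, normalized to x/|x|, would be a unit vector a with M n(a)^2 < 1/4. *)
Lemma norm_minimal x : `|x| ^+ 2 <= 4 * M * n x ^+ 2.
Proof.
have [->|x0] := eqVneq x 0.
  rewrite normr0 expr0n/= mulr_ge0//; first by rewrite mulr_ge0.
  by rewrite exprn_ge0// n_ge0.
have xp : 0 < `|x| by rewrite normr_gt0.
rewrite leNgt; apply/negP => h.
apply: (@no_small_unit_vector (`|x|^-1 *: x)).
  by rewrite normrZ normfV normr_id mulVf// gt_eqF.
rewrite n_scale normfV normr_id exprMn exprVn mulrCA mulrC.
rewrite ltr_pdivrMr ?exprn_gt0//; lra.
Qed.

End minimality.

(** * From continuity to norm bounds *)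

Lemma homogeneous_trilinear_bound (K : numFieldType) (F : lmodType K)
  (n : F -> K) (cj : K -> K) (t : F -> F -> F -> F) (e : K) :
  (forall x, 0 <= n x) -> (forall k x, n (k *: x) = `|k| * n x) ->
  (forall x, n x = 0 -> x = 0) -> (forall k, `|cj k| = `|k|) ->
  (forall k x y z, t (k *: x) y z = k *: t x y z) ->
  (forall k x y z, t x (k *: y) z = cj k *: t x y z) ->
  (forall k x y z, t x y (k *: z) = k *: t x y z) ->
  0 < e ->
  (forall x y z, n x < e -> n y < e -> n z < e -> n (t x y z) < 1) ->
  exists2 M, 0 <= M & forall x y z, n (t x y z) <= M * n x * n y * n z.
Proof.
move=> n_ge0 nZ n_sep cjN t1 t2 t3 e0 he.
have d0 : 0 < e / 2 by rewrite divr_gt0.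
have n0 : n 0 = 0 by rewrite -(scale0r 0) nZ normr0 mul0r.
(* Zero vectors are set apart, since the rescaling divides by the norms. *)
have t0 x y z : n x * n y * n z = 0 -> n (t x y z) = 0.
  move=> /eqP; rewrite !mulf_eq0 -orbA => /or3P[]/eqP/n_sep ->.
  - by rewrite -(scale0r 0) t1 nZ normr0 mul0r.
  - by rewrite -(scale0r 0) t2 nZ cjN normr0 mul0r.
  - by rewrite -(scale0r 0) t3 nZ normr0 mul0r.
exists ((e / 2) ^- 3); first by rewrite invr_ge0 exprn_ge0 ?ltW.
move=> x y z; have [xyz|xyz] := eqVneq (n x * n y * n z) 0.
  by rewrite t0// -!mulrA [n x * _]mulrA xyz mulr0.
move: xyz; rewrite !mulf_eq0 !negb_or => /andP[/andP[x0 y0] z0].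
(* Rescaling to size e/2 stays strictly inside the e-ball and yields the constant (e/2)^-3. *)
have sm w : n w != 0 -> n ((e / 2 / n w) *: w) < e.
  move=> w0; rewrite nZ ger0_norm; last by rewrite divr_ge0// ltW.
  rewrite divfK//.
  by rewrite ltr_pdivrMr// mulr_natr mulr2n ltrDl.
have := he _ _ _ (sm x x0) (sm y y0) (sm z z0).
have aw w : `|e / 2 / n w| = e / 2 / n w.
  by rewrite ger0_norm// divr_ge0// ltW.
rewrite t1 t2 t3 !nZ cjN !aw.
move=> /ltW h.
have p0 : 0 < n x * n y * n z by rewrite !mulr_gt0// lt0r ?x0 ?y0 ?z0/=.
rewrite -!mulrA ler_pdivlMl ?exprn_gt0//.
have -> : (e / 2) ^+ 3 * n (t x y z) = (n x * (n y * n z)) *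
    (e / 2 / n x * (e / 2 / n y * (e / 2 / n z * n (t x y z)))).
  by field; rewrite x0 y0 z0.
by rewrite -[leRHS]mulr1 ler_wpM2l// !mulr_ge0.
Qed.

Lemma homogeneous_bound (R : realType) (E : normedModType R) (n : E -> R) (e : R) :
  (forall k x, n (k *: x) = `|k| * n x) -> 0 < e ->
  (forall x, `|x| < e -> n x < 1) ->
  exists2 D, 0 <= D & forall x, n x <= D * `|x|.
Proof.
move=> nZ e0 he; exists (e / 2)^-1; first by rewrite invr_ge0 divr_ge0// ltW.
move=> x; have [->|x0] := eqVneq x 0.
  by rewrite -(scale0r 0) nZ !normr0 mul0r scale0r normr0 mulr0.
have xp : 0 < `|x| by rewrite normr_gt0.
have d0 : 0 < e / 2 / `|x| by rewrite !divr_gt0.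
have := he (e / 2 / `|x| *: x); rewrite normrZ nZ gtr0_norm// divfK ?normr_eq0//.
move=> h; have {}h := h ltac:(lra).
rewrite ler_pdivlMl ?divr_gt0//.
by apply: ltW; rewrite -[ltRHS]mulr1 -ltr_pdivrMl// mulrA [_^-1 * _]mulrC.
Qed.

Lemma normed_triple_bound (K : numFieldType) (cj : K -> K) (F : normedModType K)
  (tp : F -> F -> F -> F) :
  (forall k, `|cj k| = `|k|) -> normed_jordan_triple cj tp ->
  exists2 M, 0 <= M & forall x y z, `|tp x y z| <= M * `|x| * `|y| * `|z|.
Proof.
move=> cjN h.
have tp1 y z : linear (fun x => tp x y z) := tp_linear_outer h y z.
have t1 k x y z : tp (k *: x) y z = k *: tp x y z.
  pose T := HB.pack (fun x => tp x y z) (GRing.isLinear.Build K F F *:%R _ (tp1 y z)) : {linear F -> F}.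
  exact: (linearZ_LR T).
have t3 k x y z : tp x y (k *: z) = k *: tp x y z.
  by rewrite (tp_sym_outer h) t1 (tp_sym_outer h).
(* The scalar 1 at zero vectors gives [cj 1 *: tp x 0 z = 0], and [cj 1] has modulus 1. *)
have t20 x z : tp x 0 z = 0.
  have := tp_conj_linear_middle h x z 1 0 0; rewrite scaler0 addr0.
  move=> /eqP; rewrite -[X in X == _]add0r (inj_eq (addIr _)) eq_sym scaler_eq0.
  by rewrite -normr_eq0 cjN normr1 oner_eq0/= => /eqP.
have t2 k x y z : tp x (k *: y) z = cj k *: tp x y z.
  by have := tp_conj_linear_middle h x z k y 0; rewrite t20 !addr0.
have /(_ (0, 0, 0)) := tp_continuous h.
move=> /cvgrPdist_lt /= /(_ 1 ltr01); rewrite t20.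
move=> /nbhs_ballP [e /= e0 he].
apply: (@homogeneous_trilinear_bound K F Num.norm cj tp e) => //.
- by move=> k x; rewrite normrZ.
- by move=> x; apply: normr0_eq0.
move=> x y z hx hy hz; have := he (x, y, z); rewrite /= sub0r normrN; apply.
by split; [split|]; rewrite -ball_normE /ball_ /= sub0r normrN.
Qed.

Lemma triple_norm_bound (R : realType) (E : completeNormedModType R)
  (tp : E -> E -> E -> E) (n : E -> R) :
  JstarB_triple tp -> triple_norm tp n ->
  exists2 M, 0 <= M & forall x y z, n (tp x y z) <= M * n x * n y * n z.
Proof.
move=> hE [[n_tri nZ n_sep] nC].
have n0 : n 0 = 0 by rewrite -(scale0r 0) nZ normr0 mul0r.
have nN x : n (- x) = n x by rewrite -scaleN1r nZ normrN1 mul1r.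
have n_ge0 x : 0 <= n x by have := n_tri x (- x); rewrite subrr n0 nN; lra.
have t1 k x y z : tp (k *: x) y z = k *: tp x y z := linear_fun_scale (tp_linear1 hE y z) k x.
have t2 k x y z : tp x (k *: y) z = k *: tp x y z := linear_fun_scale (tp_linear2 hE x z) k y.
have t3 k x y z : tp x y (k *: z) = k *: tp x y z := linear_fun_scale (tp_linear3 hE x y) k z.
have t0 : tp 0 0 0 = 0 by have := t1 0 0 0 0; rewrite !scale0r.
have /(_ [set y | n y < 1]) := nC 0 0 0.
case.
  by exists 1 => //= y; rewrite t0 /ball_/= sub0r nN.
move=> [A B] [[[A1 A2] [[e1 /= e10 h1] [e2 /= e20 h2]] hA] [e3 /= e30 h3]] sub.
apply: (@homogeneous_trilinear_bound R E n id tp (Num.min e1 (Num.min e2 e3))) => //.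
  by rewrite !lt_min e10 e20.
move=> x y z; rewrite !lt_min => /and3P[x1 x2 x3] /and3P[y1 y2 y3] /and3P[z1 z2 z3].
apply: (sub (x, y, z)); split; last by apply: h3; rewrite /ball_/= sub0r nN.
apply: hA; split => /=; first by apply: h1; rewrite /ball_/= sub0r nN.
by apply: h2; rewrite /ball_/= sub0r nN.
Qed.

Lemma norm_minimal_linear (R : realType) (E : completeNormedModType R)
  (tp : E -> E -> E -> E) (n : E -> R) (D M : R) :
  JstarB_triple tp ->
  (forall x y, n (x + y) <= n x + n y) ->
  (forall (k : R) x, n (k *: x) = `|k| * n x) ->
  (forall x, n x = 0 -> x = 0) ->
  (forall x, n x <= D * `|x|) ->
  (forall x y z, n (tp x y z) <= M * n x * n y * n z) ->
  0 <= D -> 0 <= M ->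
  exists2 c : R, 0 < c & forall x, c * `|x| <= n x.
Proof.
move=> hE n_tri nZ n_sep n_dom n_tp D0 M0.
have b0 : 0 < 4 * M + 1 by rewrite ltr_wpDl// mulr_ge0.
(* 4M <= (4M + 1)^2 avoids a square root and covers M = 0. *)
exists (4 * M + 1)^-1; first by rewrite invr_gt0.
move=> x; have n0 := n_ge0 n_tri nZ x.
rewrite ler_pdivrMl// -(@ler_pXn2r _ 2)// ?nnegrE//; last by rewrite mulr_ge0// ltW.
apply: (le_trans (norm_minimal hE n_tri nZ n_sep n_dom n_tp D0 M0 x)).
rewrite exprMn ler_wpM2r ?exprn_ge0//.
have : 0 <= M * M by rewrite mulr_ge0.
by rewrite expr2; lra.
Qed.
Theorem proposition6 (R : realType) (E : completeNormedModType R)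
    (tpE : E -> E -> E -> E) (hE : JstarB_triple tpE) :
  [/\ (* F a real normed Jordan triple *)
      forall (F : normedModType R) (tpF : F -> F -> F -> F)
        (T : {linear E -> F}),
        normed_jordan_triple id tpF ->
        continuous T -> injective T -> triple_hom tpE tpF T ->
        exists2 c : R, 0 < c & forall x : E, c * `|x| <= `|T x|,
      (* F a complex normed Jordan triple, T real-linear *)
      forall (F : normedModType R[i]) (tpF : F -> F -> F -> F)
        (T : {linear E -> F | real_complex R \; *:%R}),
        normed_jordan_triple (@conjc R) tpF ->
        continuous T -> injective T -> triple_hom tpE tpF T ->
        exists2 c : R, 0 < c & forall x : E, (c * `|x|)%:C <= `|T x|
    & MOTNT tpE].
Proof.
have domination (F : normedModType R) (T : {linear E -> F}) : continuous T ->
    exists2 e : R, 0 < e & forall x, `|x| < e -> `|T x| < 1.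
  move=> /(_ 0)/cvgrPdist_lt/(_ 1 ltr01)/nbhs_ballP[e /= e0 he].
  exists e => // x xe; have := he x; rewrite linear0 sub0r normrN; apply.
  by rewrite -ball_normE /ball_/= sub0r normrN.
split.
- move=> F tpF T hF cT iT hT.
  (* The estimate is applied to the pulled-back norm x -> |T x|, definite by injectivity; the
     homomorphism property transports the bound on [tpF]. *)
  have nZ (k : R) x : `|T (k *: x)| = `|k| * `|T x| by rewrite linearZ/= normrZ.
  have [e e0 he] := domination F T cT.
  have [D D0 hD] := homogeneous_bound nZ e0 he.
  have [M M0 hM] := normed_triple_bound (fun=> erefl) hF.
  apply: (norm_minimal_linear hE _ nZ _ hD _ D0 M0).
  + by move=> x y; rewrite linearD ler_normD.
  + by move=> x /normr0_eq0; rewrite -(linear0 T) => /iT.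
  + by move=> x y z; rewrite hT.
- move=> F tpF T hF cT iT hT.
  (* The norm of [F] takes values in [R[i]]; its real part is the real norm on [E] to be
     compared. *)
  pose n x := complex.Re `|T x|.
  have nE x : (n x)%:C = `|T x| by rewrite RRe_real// normr_real.
  have nZ (k : R) x : n (k *: x) = `|k| * n x.
    apply: (@complexI R); rewrite nE rmorphM/= nE linearZ/= normrZ.
    by congr (_ * _); rewrite normc_def/= expr0n addr0 sqrtr_sqr.
  have [e e0 he] : exists2 e : R, 0 < e & forall x, `|x| < e -> n x < 1.
    have /(_ 0)/cvgrPdist_lt/(_ 1 ltr01)/nbhs_ballP[e /= e0 he] := cT.
    exists e => // x xe; rewrite -ltcR nE.
    have := he x; rewrite linear0 sub0r normrN; apply.
    by rewrite -ball_normE /ball_/= sub0r normrN.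
  have [D D0 hD] := homogeneous_bound nZ e0 he.
  have [M M0 hM] := normed_triple_bound (@normcJ R) hF.
  have MR : M = (complex.Re M)%:C by rewrite RRe_real// ger0_real.
  have M0' : 0 <= complex.Re M by rewrite -lecR -MR.
  have [c c0 hc] : exists2 c : R, 0 < c & forall x, c * `|x| <= n x.
    apply: (norm_minimal_linear hE _ nZ _ hD _ D0 M0').
    + by move=> x y; rewrite -lecR rmorphD/= !nE linearD ler_normD.
    + move=> x /(congr1 (real_complex R)); rewrite nE => /normr0_eq0.
      by rewrite -(linear0 T) => /iT.
    + by move=> x y z; rewrite -lecR !rmorphM/= -MR !nE hT.
  by exists c => // x; rewrite -nE lecR.
- move=> n hn [C hC] x.
  have [[n_tri nZ n_sep] _] := hn.
  have [M M0 hM] := triple_norm_bound hE hn.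
  (* Made positive so that the radius e/D makes sense. *)
  pose D := `|C| + 1.
  have Dp : 0 < D by rewrite ltr_wpDl.
  have hD y : n y <= D * `|y|.
    apply: (le_trans (hC y)); rewrite ler_wpM2r// (le_trans (ler_norm C))//.
    by rewrite lerDl.
  have [c c0 hc] := norm_minimal_linear hE n_tri nZ n_sep hD hM (ltW Dp) M0.
  (* Domination by D makes n-neighbourhoods norm neighbourhoods; the lower bound c gives the
     converse. *)
  rewrite predeqE => A; split.
    move=> [e /= e0 he]; apply/nbhs_ballP.
    exists (e / D) => /=; first by rewrite divr_gt0.
    move=> y; rewrite -ball_normE /ball_/= => hy; apply: he.
    by rewrite /ball_/= (le_lt_trans (hD _))// mulrC -ltr_pdivlMr.
  move=> /nbhs_ballP[e /= e0 he]; exists (c * e) => /=; first by rewrite mulr_gt0.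
  move=> y; rewrite /ball_/= => hy; apply: he; rewrite -ball_normE /ball_/=.
  by rewrite -(ltr_pM2l c0) (le_lt_trans (hc _)).
Qed.
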